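(* Let $\Gamma$ be either the collection of all subsets of $\mathcal P(\omega)$ or the collection of all projective subsets of $\mathcal P(\omega)$. Suppose: (i) the Principle of Dependent Choice holds; (ii) for every relation $R\subseteq[\omega]^\infty\times[\omega]^\infty$ in $\Gamma$ with $\mathrm{dom}(R)=[\omega]^\infty$ there are $A\in[\omega]^\infty$ and a function $f$ with domain $[A]^\infty$ with $(x,f(x))\in R$ for all $x\in[A]^\infty$; (iii) every set in $\Gamma$ has the Ramsey property. Then there is no infinite $\mathrm{Fin}\times\mathrm{Fin}$-mad family in $\Gamma$.
   Context: Work in $\mathsf{ZF}$. $[A]^\infty$ is the set of infinite subsets of $A$. A set $X\subseteq[\omega]^\infty$ has the Ramsey property if there is $B\in[\omega]^\infty$ with $[B]^\infty\subseteq X$ or $[B]^\infty\cap X=\emptyset$. For $X\subseteq\omega\times\omega$ and $n\in\omega$ let $X(n)=\{m:(n,m)\in X\}$. $\mathrm{Fin}\times\mathrm{Fin}$ is the ideal on $\omega\times\omega$ of those $X$ for which $\{n:X(n)\text{ is infinite}\}$ is finite. A $\mathrm{Fin}\times\mathrm{Fin}$-mad family is a family $\mathcal A$ of subsets of $\omega\times\omega$ not in $\mathrm{Fin}\times\mathrm{Fin}$, such that $A\cap B\in\mathrm{Fin}\times\mathrm{Fin}$ for distinct $A,B\in\mathcal A$, and maximal under inclusion among such families. Subsets of $\mathcal P(\omega\times\omega)$ and relations on $[\omega]^\infty$ are regarded as subsets of Polish spaces via $\mathcal P(\omega\times\omega)\cong\mathcal P(\omega)\cong 2^\omega$, so membership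 in $\Gamma$ makes sense. *)

(* Defs.v *)
(* "Work in ZF" is rendered by quantifying over all models of first-order ZF.
   Stating the theorem about Rocq's own sets of reals would not do: with the
   usual choice axioms of classical Rocq, "every set has the Ramsey property"
   is refutable, and the theorem would be vacuous for the class of all sets.
   Separation and Replacement are schemas over first-order formulas with
   parameters, so a model need not satisfy AC. All notions below are
   interpreted inside the model: every quantifier over sets, functions,
   relations and natural numbers ranges over elements of the carrier. *)

(* De Bruijn syntax: [fAll] and [fEx] bind index 0. *)
Inductive formula : Type :=
| fMem (i j : nat)
| fEq (i j : nat)
| fFalse
| fImp (p q : formula)
| fAnd (p q : formula)
| fOr (p q : formula)
| fAll (p : formula)
| fEx (p : formula).

Definition scons {V : Type} (x : V) (e : nat -> V) (k : nat) : V :=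
  match k with O => x | S k' => e k' end.

Fixpoint sat {V : Type} (E : V -> V -> Prop) (e : nat -> V) (p : formula)
  : Prop :=
  match p with
  | fMem i j => E (e i) (e j)
  | fEq i j => e i = e j
  | fFalse => False
  | fImp p q => sat E e p -> sat E e q
  | fAnd p q => sat E e p /\ sat E e q
  | fOr p q => sat E e p \/ sat E e q
  | fAll p => forall x, sat E (scons x e) p
  | fEx p => exists x, sat E (scons x e) p
  end.

Record ZF_model : Type := {
  carrier :> Type;
  mem : carrier -> carrier -> Prop;
  extensionality : forall x y, (forall z, mem z x <-> mem z y) -> x = y;
  foundation : forall x, (exists y, mem y x) ->
    exists y, mem y x /\ ~ exists z, mem z y /\ mem z x;
  pairing : forall x y, exists z, forall w, mem w z <-> w = x \/ w = y;
  union : forall x, exists z, forall w,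
    mem w z <-> exists y, mem y x /\ mem w y;
  power_set : forall x, exists z, forall w,
    mem w z <-> forall t, mem t w -> mem t x;
  infinity : exists z,
    (exists o, (forall t, ~ mem t o) /\ mem o z) /\
    forall n, mem n z ->
      exists s, (forall t, mem t s <-> mem t n \/ t = n) /\ mem s z;
  separation : forall (p : formula) (e : nat -> carrier) a,
    exists z, forall x, mem x z <-> mem x a /\ sat mem (scons x e) p;
  replacement : forall (p : formula) (e : nat -> carrier) a,
    (forall x, mem x a -> forall y y',
       sat mem (scons y (scons x e)) p -> sat mem (scons y' (scons x e)) p ->
       y = y') ->
    exists z, forall y,
      mem y z <-> exists x, mem x a /\ sat mem (scons y (scons x e)) p
}.

Arguments mem {_} _ _.

Declare Scope zf_scope.
Delimit Scope zf_scope with zf.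
Notation "x ∈ y" := (mem x y) (at level 70, no associativity) : zf_scope.
Notation "x ∉ y" := (~ mem x y) (at level 70, no associativity) : zf_scope.
Open Scope zf_scope.

Section Internal.

Context {M : ZF_model}.

(* Classes are predicates [M -> Prop]; [elts a] is the class of elements of
   the set [a]. *)
Definition elts (a : M) : M -> Prop := fun x => x ∈ a.

Definition is_empty (o : M) : Prop := forall t, t ∉ o.
Definition is_succ (s n : M) : Prop := forall t, t ∈ s <-> t ∈ n \/ t = n.

(* The class of von Neumann natural numbers of [M], so that [k ∈ n] is the
   order [k < n], and 1 is the successor of the empty set. *)
Definition inductive_set (z : M) : Prop :=
  (exists o, is_empty o /\ o ∈ z) /\
  forall n, n ∈ z -> exists s, is_succ s n /\ s ∈ z.
Definition omega (n : M) : Prop := forall z, inductive_set z -> n ∈ z.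

Definition is_one (i : M) : Prop := exists o, is_empty o /\ is_succ i o.

(* Kuratowski pairs: [p = {{x}, {x, y}}]. *)
Definition is_upair (p x y : M) : Prop := forall t, t ∈ p <-> t = x \/ t = y.
Definition is_pair (p x y : M) : Prop :=
  exists s d, is_upair s x x /\ is_upair d x y /\ is_upair p s d.

Definition prodc (P Q : M -> Prop) : M -> Prop :=
  fun p => exists x y, P x /\ Q y /\ is_pair p x y.

Definition rel (r x y : M) : Prop := exists p, is_pair p x y /\ p ∈ r.

Definition maps (f : M) (P Q : M -> Prop) : Prop :=
  (forall p, p ∈ f -> prodc P Q p) /\ (forall x, P x -> exists! y, rel f x y).

Definition bijection (f : M) (P Q : M -> Prop) : Prop :=
  maps f P Q /\
  (forall x x' y, rel f x y -> rel f x' y -> x = x') /\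
  (forall y, Q y -> exists x, rel f x y).

Definition image (f a b : M) : Prop :=
  forall y, y ∈ b <-> exists x, x ∈ a /\ rel f x y.

Definition finite (P : M -> Prop) : Prop :=
  exists n f, omega n /\ bijection f (elts n) P.

(* [infsubs P] is [P]^∞. *)
Definition infsubs (P : M -> Prop) : M -> Prop :=
  fun x => (forall n, n ∈ x -> P n) /\ ~ finite (elts x).

Definition dependent_choice : Prop :=
  forall a r : M,
    (exists x, x ∈ a) ->
    (forall p, p ∈ r -> prodc (elts a) (elts a) p) ->
    (forall x, x ∈ a -> exists y, y ∈ a /\ rel r x y) ->
    exists f, maps f omega (elts a) /\
      forall n s x y, omega n -> is_succ s n ->
        rel f n x -> rel f s y -> rel r x y.

Definition ramsey (X : M) : Prop :=
  exists B, infsubs omega B /\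
    ((forall x, infsubs (elts B) x -> x ∈ X) \/
     (forall x, infsubs (elts B) x -> x ∉ X)).

(** Fin × Fin *)

Definition fin_fin (X : M -> Prop) : Prop :=
  (forall p, X p -> prodc omega omega p) /\
  finite (fun n => omega n /\
    ~ finite (fun m => omega m /\ exists p, is_pair p n m /\ X p)).

Definition fin_fin_ad (F : M) : Prop :=
  (forall A, A ∈ F -> (forall p, p ∈ A -> prodc omega omega p) /\
                      ~ fin_fin (elts A)) /\
  (forall A B, A ∈ F -> B ∈ F -> A <> B ->
     fin_fin (fun p => p ∈ A /\ p ∈ B)).

Definition fin_fin_mad (F : M) : Prop :=
  fin_fin_ad F /\
  forall G, fin_fin_ad G -> (forall A, A ∈ F -> A ∈ G) -> G = F.

(** Projective subsets of P(ω), identified with the Cantor space 2^ω *)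

Definition real (x : M) : Prop := forall k, k ∈ x -> omega k.

Definition set_of_reals (X : M) : Prop := forall x, x ∈ X -> real x.

(* [x ∩ n = y ∩ n]; these relations generate the topology of 2^ω. *)
Definition agree (x y n : M) : Prop := forall k, k ∈ n -> (k ∈ x <-> k ∈ y).

Definition open_set (U : M) : Prop :=
  set_of_reals U /\
  forall x, x ∈ U -> exists n, omega n /\
    forall y, real y -> agree x y n -> y ∈ U.

Definition compl (Y X : M) : Prop := forall x, x ∈ Y <-> real x /\ x ∉ X.

Definition sigma_algebra (F : M) : Prop :=
  (forall X, X ∈ F -> set_of_reals X) /\
  (forall X Y, X ∈ F -> compl Y X -> Y ∈ F) /\
  (forall f Y, maps f omega (elts F) ->
     (forall x, x ∈ Y <-> exists n X, rel f n X /\ x ∈ X) -> Y ∈ F).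

Definition borel (X : M) : Prop :=
  set_of_reals X /\
  forall F, sigma_algebra F -> (forall U, open_set U -> U ∈ F) -> X ∈ F.

Definition continuous (f : M) : Prop :=
  maps f real real /\
  forall x n, real x -> omega n -> exists m, omega m /\
    forall y x' y', real y -> agree x y m -> rel f x x' -> rel f y y' ->
      agree x' y' n.

Definition continuous_image (X B : M) : Prop :=
  exists f, continuous f /\ image f B X.

(* [h n] is the class Σ^1_{n+1} of subsets of 2^ω: Σ^1_1 sets are the
   continuous images of Borel sets, and Σ^1_{n+1} sets the continuous images
   of complements of Σ^1_n sets. As 2^ω × 2^ω is homeomorphic to 2^ω,
   projections are covered. The index ranges over the naturals of [M]. *)
Definition projective_hierarchy (h : M) : Prop :=
  maps h omega (fun _ => True) /\
  (forall o S, is_empty o -> rel h o S ->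
     forall X, X ∈ S <-> exists B, borel B /\ continuous_image X B) /\
  (forall n s S T, omega n -> is_succ s n -> rel h n S -> rel h s T ->
     forall X, X ∈ T <->
       exists Y P, Y ∈ S /\ compl P Y /\ continuous_image X P).

Definition projective (X : M) : Prop :=
  exists h n S, projective_hierarchy h /\ omega n /\ rel h n S /\ X ∈ S.

(** Transfer of a class [Gamma] of sets of reals to other spaces *)

(* For a countable [D], a set [S] of subsets of [D] is in [Gamma] when its
   image under P(D) ≅ P(ω) is, the homeomorphism being induced by a bijection
   of [D] with ω. For the two classes of interest the choice of the bijection
   is immaterial. *)
Definition in_class (Gamma : M -> Prop) (D : M -> Prop) (S : M) : Prop :=
  (forall x, x ∈ S -> forall t, t ∈ x -> D t) /\
  exists e T, bijection e D omega /\
    (forall z, z ∈ T <-> exists x, x ∈ S /\ image e x z) /\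
    Gamma T.

(* P(ω) × P(ω) ≅ P({0,1} × ω), via (x, y) ↦ {0} × x ∪ {1} × y. *)
Definition two_omega : M -> Prop :=
  prodc (fun i => is_empty i \/ is_one i) omega.

Definition join (z x y : M) : Prop :=
  forall t, t ∈ z <->
    prodc is_empty (elts x) t \/ prodc is_one (elts y) t.

Definition rel_in_class (Gamma : M -> Prop) (R : M) : Prop :=
  exists S, (forall z, z ∈ S <-> exists x y, rel R x y /\ join z x y) /\
    in_class Gamma two_omega S.

End Internal.

Arguments dependent_choice M : clear implicits.

(* Main.v *)
(* Let A_0, A_1, ... be distinct members of a mad family F. An infinite set z of
   natural numbers is cut into consecutive blocks p_i < q_i < r_i. The pair
   (p_i, q_i) selects a column of A_(p_i), namely its first infinite column of
   index at least q_i, and each r_i selects a point in the column of an earlier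
   block j, every j being used for infinitely many i. This codes a set x_z that
   is not in Fin x Fin. Apply the Ramsey property to the set X of those z for
   which x_z is included in some y in F, and let B be homogeneous. By
   maximality some y in F has infinite intersection with infinitely many
   columns coded from B. Using these columns only and thinning out the r_i, one
   finds z in [B]^inf with x_z included in y, so [B]^inf is not disjoint from X.
   Replacing just the first column by one meeting y in a finite set (possible as
   A_p differs from y for some p in B) one finds z such that only y can include
   x_z, but does not, so [B]^inf is not included in X either.

   If F is projective then so is X: the relation "x_z is included in y" is
   closed in z and y, and by induction inside the model each level of the
   hierarchy is closed under intersections with Borel sets and continuous
   preimages. *)

Require Import Defs.
From Stdlib Require Import Classical ClassicalEpsilon.

(** * Definability with parameters *)

(** The three numbers of a block have separate duties: [p] names a member of the family, [q] moves
    the column to the right of any given bound, [r] moves a point above any given height. Moving [q]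
    is what makes one column nearly miss [y], since almost disjointness says nothing about the first
    few columns. Taking the first column and the first height makes the point a function of [p],
    [q], [r], so that no choice is hidden in the coding. Reading blocks from initial segments of [z]
    makes membership in the coded set an open condition on [z], whence the closed relation of the
    projective case.

    The other obstacle is the setting. The naturals of the model may be nonstandard and its schemas
    speak of formulas only, so each set formed and each induction made inside the model needs a
    proof that the property is definable with parameters. A statement about Rocq predicates must be
    recast with set variables before it can be proved by such an induction. *)

Fixpoint rename (r : nat -> nat) (p : formula) : formula :=
  let up k := match k with O => O | S k => S (r k) end in
  match p with
  | fMem i j => fMem (r i) (r j)
  | fEq i j => fEq (r i) (r j)
  | fFalse => fFalse
  | fImp p q => fImp (rename r p) (rename r q)
  | fAnd p q => fAnd (rename r p) (rename r q)
  | fOr p q => fOr (rename r p) (rename r q)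
  | fAll p => fAll (rename up p)
  | fEx p => fEx (rename up p)
  end.

Lemma sat_rename {V : Type} (E : V -> V -> Prop) (p : formula) :
  forall r e e', (forall k, e' k = e (r k)) ->
  (sat E e (rename r p) <-> sat E e' p).
Proof.
  induction p as [i j|i j| |p IHp q IHq|p IHp q IHq|p IHp q IHq|p IHp|p IHp];
    intros r e e' H; simpl; rewrite ?H.
  1-3: tauto.
  1-3: specialize (IHp _ _ _ H); specialize (IHq _ _ _ H); tauto.
  1-2: assert (K : forall x, sat E (scons x e)
      (rename (fun k => match k with O => O | S k => S (r k) end) p) <->
      sat E (scons x e') p) by
      (intros x; apply IHp; intros [|k]; [reflexivity|apply H]).
  - split; intros G x; apply K, G.
  - split; intros [x G]; exists x; apply K, G.
Qed.

Fixpoint double (k : nat) : nat :=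
  match k with O => O | S k => S (S (double k)) end.

Fixpoint half (k : nat) : nat + nat :=
  match k with
  | O => inl O
  | S k => match half k with inl i => inr i | inr i => inl (S i) end
  end.

Lemma half_even k : half (double k) = inl k.
Proof. induction k as [|k IH]; simpl; [|rewrite IH]; reflexivity. Qed.

Lemma half_odd k : half (S (double k)) = inr k.
Proof. simpl; rewrite half_even; reflexivity. Qed.

Definition mix {V : Type} (e c : nat -> V) (k : nat) : V :=
  match half k with inl i => e i | inr i => c i end.

Lemma mix_even {V : Type} (e c : nat -> V) k : mix e c (double k) = e k.
Proof. unfold mix; rewrite half_even; reflexivity. Qed.

Lemma mix_odd {V : Type} (e c : nat -> V) k : mix e c (S (double k)) = c k.
Proof. unfold mix; rewrite half_odd; reflexivity. Qed.

Section Definability.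

Context {M : ZF_model}.

(* First-order definability with parameters: the even variables of the formula
   carry the arguments, the odd ones the parameters. *)
Definition definable (P : (nat -> M) -> Prop) : Prop :=
  exists p c, forall e, sat mem (mix e c) p <-> P e.

Definition dterm (t : (nat -> M) -> M) : Prop :=
  definable (fun e => e 0 = t (fun k => e (S k))).

Definition def1 (P : M -> Prop) := definable (fun e => P (e 0)).
Definition def2 (P : M -> M -> Prop) := definable (fun e => P (e 0) (e 1)).
Definition def3 (P : M -> M -> M -> Prop) :=
  definable (fun e => P (e 0) (e 1) (e 2)).
Definition def4 (P : M -> M -> M -> M -> Prop) :=
  definable (fun e => P (e 0) (e 1) (e 2) (e 3)).
Definition def5 (P : M -> M -> M -> M -> M -> Prop) :=
  definable (fun e => P (e 0) (e 1) (e 2) (e 3) (e 4)).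
Definition dfun1 (F : M -> M) := def2 (fun y x => y = F x).
Definition dfun2 (F : M -> M -> M) := def3 (fun y x1 x2 => y = F x1 x2).

Lemma definable_iff (P Q : (nat -> M) -> Prop) :
  (forall e, P e <-> Q e) -> definable P -> definable Q.
Proof.
  intros H [p [c Hp]]. exists p, c. intros e. rewrite Hp. apply H.
Qed.

Lemma definable_subst (r : nat -> nat) (P : (nat -> M) -> Prop) :
  definable P -> definable (fun e => P (fun k => e (r k))).
Proof.
  intros [p [c Hp]].
  exists (rename (fun j => match half j with
                           | inl k => double (r k)
                           | inr k => S (double k) end) p), c.
  intros e. rewrite <- Hp. apply sat_rename. intros k. unfold mix at 1.
  destruct (half k); rewrite ?mix_even, ?mix_odd; reflexivity.
Qed.

Lemma definable_mem i j : definable (fun e => e i ∈ e j).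
Proof.
  (* No parameter occurs, but the parameter list must be some function into the carrier; infinity
     supplies an element. *)
  destruct (infinity M) as [z _].
  exists (fMem (double i) (double j)), (fun _ => z). intros e. simpl.
  rewrite !mix_even. tauto.
Qed.

Lemma definable_eq i j : definable (fun e => e i = e j).
Proof.
  destruct (infinity M) as [z _].
  exists (fEq (double i) (double j)), (fun _ => z). intros e. simpl.
  rewrite !mix_even. tauto.
Qed.

Lemma definable_eq_const i a : definable (fun e => e i = a).
Proof.
  exists (fEq (double i) 1), (fun _ => a). intros e. simpl.
  rewrite mix_even. tauto.
Qed.

Lemma definable_False : definable (fun _ => False).
Proof.
  destruct (infinity M) as [z _].
  exists fFalse, (fun _ => z). intros e. simpl. tauto.
Qed.

(** The two parameter lists are interleaved in their turn: one goes to the even places of the new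
    list, the other to the odd places. All binary connectives rest on this. *)
Lemma definable_common_parameters (P Q : (nat -> M) -> Prop) :
  definable P -> definable Q ->
  exists p q c, (forall e, sat mem (mix e c) p <-> P e) /\
                (forall e, sat mem (mix e c) q <-> Q e).
Proof.
  intros [p [c Hp]] [q [d Hq]].
  exists (rename (fun j => match half j with
                           | inl k => double k
                           | inr k => S (double (double k)) end) p),
         (rename (fun j => match half j with
                           | inl k => double k
                           | inr k => S (double (S (double k))) end) q),
         (mix c d).
  split; intros e; [rewrite <- Hp|rewrite <- Hq]; apply sat_rename;
    intros k; unfold mix at 1; destruct (half k);
    rewrite ?mix_even, ?mix_odd, ?mix_even, ?mix_odd; reflexivity.
Qed.

Lemma definable_imp (P Q : (nat -> M) -> Prop) :
  definable P -> definable Q -> definable (fun e => P e -> Q e).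
Proof.
  intros HP HQ.
  destruct (definable_common_parameters _ _ HP HQ) as [p [q [c [Hp Hq]]]].
  exists (fImp p q), c. intros e. simpl. rewrite Hp, Hq. tauto.
Qed.

Lemma definable_and (P Q : (nat -> M) -> Prop) :
  definable P -> definable Q -> definable (fun e => P e /\ Q e).
Proof.
  intros HP HQ.
  destruct (definable_common_parameters _ _ HP HQ) as [p [q [c [Hp Hq]]]].
  exists (fAnd p q), c. intros e. simpl. rewrite Hp, Hq. tauto.
Qed.

Lemma definable_or (P Q : (nat -> M) -> Prop) :
  definable P -> definable Q -> definable (fun e => P e \/ Q e).
Proof.
  intros HP HQ.
  destruct (definable_common_parameters _ _ HP HQ) as [p [q [c [Hp Hq]]]].
  exists (fOr p q), c. intros e. simpl. rewrite Hp, Hq. tauto.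
Qed.

Lemma definable_not (P : (nat -> M) -> Prop) :
  definable P -> definable (fun e => ~ P e).
Proof. intros HP. apply definable_imp; [exact HP|apply definable_False]. Qed.

Lemma definable_iff_prop (P Q : (nat -> M) -> Prop) :
  definable P -> definable Q -> definable (fun e => P e <-> Q e).
Proof. intros HP HQ. apply definable_and; apply definable_imp; assumption. Qed.

(** A quantifier shifts every variable by one and so exchanges the places of arguments and
    parameters. The renaming restores the convention: under the quantifier the bound variable is
    argument 0, the outer argument [k] is argument [S k], and parameters keep their index. *)
Lemma sat_binder (p : formula) (e c : nat -> M) (x : M) :
  sat mem (scons x (mix e c))
    (rename (fun j => match half j with
                      | inl O => O
                      | inl (S k) => S (double k)
                      | inr k => S (S (double k)) end) p) <->
  sat mem (mix (scons x e) c) p.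
Proof.
  apply sat_rename. intros k. unfold mix at 1.
  destruct (half k) as [[|i]|i]; simpl; rewrite ?mix_even; try reflexivity.
  symmetry; apply mix_odd.
Qed.

Lemma definable_all (P : M -> (nat -> M) -> Prop) :
  definable (fun e => P (e 0) (fun k => e (S k))) ->
  definable (fun e => forall x, P x e).
Proof.
  intros [p [c Hp]]. eexists (fAll (rename _ p)), c. intros e. simpl.
  split; intros H x; specialize (H x).
  - apply sat_binder, Hp in H. exact H.
  - apply sat_binder, Hp. exact H.
Qed.

Lemma definable_ex (P : M -> (nat -> M) -> Prop) :
  definable (fun e => P (e 0) (fun k => e (S k))) ->
  definable (fun e => exists x, P x e).
Proof.
  intros [p [c Hp]]. eexists (fEx (rename _ p)), c. intros e. simpl.
  split; intros [x H]; exists x.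
  - apply sat_binder, Hp in H. exact H.
  - apply sat_binder, Hp. exact H.
Qed.

Lemma dterm_var i : dterm (fun e => e i).
Proof. apply (definable_eq 0 (S i)). Qed.

Lemma dterm_const a : dterm (fun _ => a).
Proof. apply (definable_eq_const 0 a). Qed.

Lemma dterm_shift (t : (nat -> M) -> M) :
  dterm t -> dterm (fun e => t (fun k => e (S k))).
Proof.
  intros Ht.
  exact (definable_subst (fun k => match k with O => O | S k => S (S k) end)
           _ Ht).
Qed.

(** A term enters a formula only through its graph, so substitution is a quantifier over its value.
    The application lemmas bind their arguments from the last to the first and shift the waiting
    terms past each new variable. *)
Lemma definable_bind (t : (nat -> M) -> M) (P : M -> (nat -> M) -> Prop) :
  dterm t -> definable (fun e => P (e 0) (fun k => e (S k))) ->
  definable (fun e => P (t e) e).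
Proof.
  intros Ht HP. apply (definable_iff (fun e => exists x, x = t e /\ P x e)).
  - intros e. split; [intros [x [-> H]]; exact H|intros H; exists (t e); auto].
  - apply definable_ex. apply definable_and; assumption.
Qed.

Lemma def1_app (P : M -> Prop) a :
  def1 P -> dterm a -> definable (fun e => P (a e)).
Proof. intros HP Ha. apply (definable_bind a (fun x e => P x)); assumption. Qed.

Lemma def2_app (P : M -> M -> Prop) a b :
  def2 P -> dterm a -> dterm b -> definable (fun e => P (a e) (b e)).
Proof.
  intros HP Ha Hb. apply (definable_bind b (fun x e => P (a e) x)); trivial.
  apply (definable_bind (fun e => a (fun k => e (S k)))
           (fun y e => P y (e 0))); [apply dterm_shift, Ha|].
  apply HP.
Qed.

Lemma def3_app (P : M -> M -> M -> Prop) a b c :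
  def3 P -> dterm a -> dterm b -> dterm c ->
  definable (fun e => P (a e) (b e) (c e)).
Proof.
  intros HP Ha Hb Hc.
  apply (definable_bind c (fun x e => P (a e) (b e) x)); trivial.
  apply (definable_bind (fun e => b (fun k => e (S k)))
           (fun y e => P (a (fun k => e (S k))) y (e 0)));
    [apply dterm_shift, Hb|].
  apply (definable_bind (fun e => a (fun k => e (S (S k))))
           (fun y e => P y (e 0) (e 1)));
    [apply (dterm_shift (fun e => a (fun k => e (S k)))), dterm_shift, Ha|].
  apply HP.
Qed.

Lemma def4_app (P : M -> M -> M -> M -> Prop) a b c d :
  def4 P -> dterm a -> dterm b -> dterm c -> dterm d ->
  definable (fun e => P (a e) (b e) (c e) (d e)).
Proof.
  intros HP Ha Hb Hc Hd.
  apply (definable_bind d (fun x e => P (a e) (b e) (c e) x)); trivial.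
  apply dterm_shift in Ha, Hb, Hc.
  apply (definable_bind _ (fun y e => P (a (fun k => e (S k)))
            (b (fun k => e (S k))) y (e 0)) Hc).
  apply dterm_shift in Ha, Hb.
  apply (definable_bind _ (fun y e => P (a (fun k => e (S (S k))))
            y (e 0) (e 1)) Hb).
  apply dterm_shift in Ha.
  apply (definable_bind _ (fun y e => P y (e 0) (e 1) (e 2)) Ha).
  apply HP.
Qed.

Lemma def5_app (P : M -> M -> M -> M -> M -> Prop) a b c d f :
  def5 P -> dterm a -> dterm b -> dterm c -> dterm d -> dterm f ->
  definable (fun e => P (a e) (b e) (c e) (d e) (f e)).
Proof.
  intros HP Ha Hb Hc Hd Hf.
  apply (definable_bind f (fun x e => P (a e) (b e) (c e) (d e) x)); trivial.
  apply dterm_shift in Ha, Hb, Hc, Hd.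
  apply (definable_bind _ (fun y e => P (a (fun k => e (S k)))
            (b (fun k => e (S k))) (c (fun k => e (S k))) y (e 0)) Hd).
  apply dterm_shift in Ha, Hb, Hc.
  apply (definable_bind _ (fun y e => P (a (fun k => e (S (S k))))
            (b (fun k => e (S (S k)))) y (e 0) (e 1)) Hc).
  apply dterm_shift in Ha, Hb.
  apply (definable_bind _ (fun y e => P (a (fun k => e (S (S (S k)))))
            y (e 0) (e 1) (e 2)) Hb).
  apply dterm_shift in Ha.
  apply (definable_bind _ (fun y e => P y (e 0) (e 1) (e 2) (e 3)) Ha).
  apply HP.
Qed.

Lemma dterm1_app (F : M -> M) a :
  dfun1 F -> dterm a -> dterm (fun e => F (a e)).
Proof.
  intros HF Ha.
  apply (def2_app (fun y x => y = F x) (fun e => e 0)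
           (fun e => a (fun k => e (S k))));
    [exact HF|apply dterm_var|apply dterm_shift, Ha].
Qed.

Lemma dterm2_app (F : M -> M -> M) a b :
  dfun2 F -> dterm a -> dterm b -> dterm (fun e => F (a e) (b e)).
Proof.
  intros HF Ha Hb.
  apply (def3_app (fun y x1 x2 => y = F x1 x2) (fun e => e 0)
           (fun e => a (fun k => e (S k))) (fun e => b (fun k => e (S k))));
    [exact HF|apply dterm_var|apply dterm_shift, Ha|apply dterm_shift, Hb].
Qed.

Lemma def2_mem : def2 (@mem M).
Proof. apply (definable_mem 0 1). Qed.

Lemma def2_eq : def2 (@eq M).
Proof. apply (definable_eq 0 1). Qed.

Lemma comprehension (P : M -> Prop) (a : M) :
  def1 P -> exists z, forall x, x ∈ z <-> x ∈ a /\ P x.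
Proof.
  intros [p [c Hp]].
  (* The predicate depends on argument 0 alone, so all even variables may be sent to the one
     variable reserved for the element; the odd ones become the parameters of the schema. *)
  destruct (separation M (rename (fun j => match half j with
      | inl k => O | inr k => S k end) p) c a) as [z Hz].
  exists z. intros x. rewrite Hz, <- (Hp (fun _ => x)).
  rewrite (sat_rename mem p _ _ (mix (fun _ => x) c)); [tauto|].
  intros k. unfold mix. destruct (half k); reflexivity.
Qed.

End Definability.

Create HintDb dfn.
#[export] Hint Resolve def2_mem def2_eq : dfn.

(* Proves [definable] and [dterm] goals by recursion on the syntax; predicates
   and functions are looked up in the hint database [dfn]. *)
Ltac dfn :=
  intros; cbv beta;
  lazymatch goal with
  | |- definable (fun e => @?A e /\ @?B e) => apply (definable_and A B); dfn
  | |- definable (fun e => @?A e \/ @?B e) => apply (definable_or A B); dfn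
  | |- definable (fun e => @?A e <-> @?B e) =>
      apply (definable_iff_prop A B); dfn
  | |- definable (fun e => ~ @?A e) => apply (definable_not A); dfn
  | |- definable (fun e => exists x, @?P x e) => apply (definable_ex P); dfn
  | |- definable (fun e => @?A e -> @?B e) => apply (definable_imp A B); dfn
  | |- definable (fun e => forall x, @?P x e) => apply (definable_all P); dfn
  | |- definable _ => first
      [ eapply def5_app; [solve [auto with dfn nocore]|dfn ..]
      | eapply def4_app; [solve [auto with dfn nocore]|dfn ..]
      | eapply def3_app; [solve [auto with dfn nocore]|dfn ..]
      | eapply def2_app; [solve [auto with dfn nocore]|dfn ..]
      | eapply def1_app; [solve [auto with dfn nocore]|dfn ..]
      | progress unfold finite, bijection, maps, prodc, elts, unique; dfn ]
  | |- dterm (fun e => e ?i) => apply (dterm_var i)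
  | |- dterm (fun _ => ?a) => apply (dterm_const a)
  | |- dterm _ => first
      [ eapply dterm2_app; [solve [auto with dfn nocore]|dfn ..]
      | eapply dterm1_app; [solve [auto with dfn nocore]|dfn ..] ]
  | |- def1 ?P => unfold def1; dfn
  | |- def2 ?P => unfold def2; dfn
  | |- def3 ?P => unfold def3; dfn
  | |- def4 ?P => unfold def4; dfn
  | |- def5 ?P => unfold def5; dfn
  end.

(** * Sets and natural numbers of the model *)

Section Sets.

Context {M : ZF_model}.
Implicit Types a b f n p t x y z : M.

(** Epsilon acts outside the model. It is applied below only to descriptions that extensionality
    makes unique, so it names sets and adds no choice inside the model. *)
Definition pick (P : M -> Prop) : M :=
  epsilon (let (z, _) := infinity M in inhabits z) P.

Lemma pick_spec (P : M -> Prop) : (exists x, P x) -> P (pick P).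
Proof. apply epsilon_spec. Qed.

Definition emp : M := pick is_empty.

Lemma notin_emp t : t ∉ emp.
Proof.
  apply (pick_spec is_empty). destruct (infinity M) as [z [[o [H _]] _]].
  exists o. exact H.
Qed.

Lemma is_empty_emp o : is_empty o <-> o = emp.
Proof.
  split; [|intros ->; exact notin_emp].
  intros H. apply extensionality. intros t.
  split; intros K; [destruct (H t K)|destruct (notin_emp t K)].
Qed.

Definition upair x y : M := pick (fun z => is_upair z x y).

Lemma in_upair x y t : t ∈ upair x y <-> t = x \/ t = y.
Proof. apply (pick_spec (fun z => is_upair z x y)), pairing. Qed.

Lemma is_upair_upair x y z : is_upair z x y <-> z = upair x y.
Proof.
  split; [|intros ->; exact (in_upair x y)].
  intros H. apply extensionality. intros t. rewrite in_upair. apply H.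
Qed.

Lemma def_empty : def1 (@is_empty M).
Proof. unfold is_empty. dfn. Qed.

Lemma def_upair : def3 (@is_upair M).
Proof. unfold is_upair. dfn. Qed.

Hint Resolve def_empty def_upair : dfn.

Lemma def_pair : def3 (@is_pair M).
Proof. unfold is_pair. dfn. Qed.

Hint Resolve def_pair : dfn.

Definition pr x y : M := upair (upair x x) (upair x y).

Lemma is_pair_pr p x y : is_pair p x y <-> p = pr x y.
Proof.
  unfold is_pair, pr. split.
  - intros [s [d [Hs [Hd Hp]]]]. apply is_upair_upair in Hs, Hd, Hp.
    subst. reflexivity.
  - intros ->. exists (upair x x), (upair x y).
    repeat split; apply is_upair_upair; reflexivity.
Qed.

Lemma upair_inj x y x' y' :
  upair x y = upair x' y' -> (x = x' /\ y = y') \/ (x = y' /\ y = x').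
Proof.
  intros H.
  assert (K : forall t, t = x \/ t = y <-> t = x' \/ t = y')
    by (intros t; rewrite <- !in_upair, H; tauto).
  pose proof (proj1 (K x) (or_introl eq_refl)).
  pose proof (proj1 (K y) (or_intror eq_refl)).
  pose proof (proj2 (K x') (or_introl eq_refl)).
  pose proof (proj2 (K y') (or_intror eq_refl)).
  intuition congruence.
Qed.

Lemma pr_inj x y x' y' : pr x y = pr x' y' -> x = x' /\ y = y'.
Proof.
  intros H. apply upair_inj in H. destruct H as [[H1 H2]|[H1 H2]];
    apply upair_inj in H1, H2; intuition congruence.
Qed.

Lemma dfun_pr : dfun2 pr.
Proof.
  apply (definable_iff (fun e => is_pair (e 0) (e 1) (e 2))).
  - intros e. apply is_pair_pr.
  - apply def_pair.
Qed.

Hint Resolve dfun_pr : dfn.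

Lemma rel_pr r x y : rel r x y <-> pr x y ∈ r.
Proof.
  unfold rel. split.
  - intros [p [H K]]. apply is_pair_pr in H. subst. exact K.
  - intros H. exists (pr x y). split; [apply is_pair_pr; reflexivity|exact H].
Qed.

Lemma def_rel : def3 (@rel M).
Proof. unfold rel. dfn. Qed.

Hint Resolve def_rel : dfn.

Lemma prodc_pr (P Q : M -> Prop) x y : prodc P Q (pr x y) <-> P x /\ Q y.
Proof.
  unfold prodc. split.
  - intros [x' [y' [Hx [Hy H]]]]. apply is_pair_pr, pr_inj in H.
    destruct H as [-> ->]. auto.
  - intros [Hx Hy]. exists x, y. rewrite is_pair_pr. auto.
Qed.

Lemma prodc_elim (P Q : M -> Prop) p :
  prodc P Q p <-> exists x y, P x /\ Q y /\ p = pr x y.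
Proof.
  unfold prodc. split; intros [x [y H]]; exists x, y;
    rewrite is_pair_pr in *; exact H.
Qed.

Lemma binary_union a b : exists z, forall t, t ∈ z <-> t ∈ a \/ t ∈ b.
Proof.
  destruct (union M (upair a b)) as [z Hz]. exists z. intros t. rewrite Hz.
  split.
  - intros [y [Hy Ht]]. apply in_upair in Hy. destruct Hy; subst; auto.
  - intros [H|H]; [exists a|exists b]; rewrite in_upair; auto.
Qed.

Definition adjoin a x : M := pick (fun z => forall t, t ∈ z <-> t ∈ a \/ t = x).

Lemma in_adjoin a x t : t ∈ adjoin a x <-> t ∈ a \/ t = x.
Proof.
  apply (pick_spec (fun z => forall t, t ∈ z <-> t ∈ a \/ t = x)).
  destruct (binary_union a (upair x x)) as [z Hz]. exists z.
  intros u. rewrite Hz, in_upair. tauto.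
Qed.

Lemma dfun_adjoin : dfun2 adjoin.
Proof.
  apply (definable_iff (fun e => forall t, t ∈ e 0 <-> t ∈ e 1 \/ t = e 2));
    [|dfn].
  intros e. split.
  - intros H. apply extensionality. intros t. rewrite H, in_adjoin. tauto.
  - intros -> t. apply in_adjoin.
Qed.

Hint Resolve dfun_adjoin : dfn.

Definition succ n : M := adjoin n n.

Lemma is_succ_succ s n : is_succ s n <-> s = succ n.
Proof.
  unfold is_succ, succ. split.
  - intros H. apply extensionality. intros t. rewrite H, in_adjoin. tauto.
  - intros -> t. apply in_adjoin.
Qed.

Lemma def_succ : def2 (@is_succ M).
Proof. unfold is_succ. dfn. Qed.

Hint Resolve def_succ : dfn.

Lemma dfun_succ : dfun1 succ.
Proof.
  apply (definable_iff (fun e => is_succ (e 0) (e 1))).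
  - intros e. apply is_succ_succ.
  - apply def_succ.
Qed.

Hint Resolve dfun_succ : dfn.

Lemma def_inductive : def1 (@inductive_set M).
Proof. unfold inductive_set. dfn. Qed.

Hint Resolve def_inductive : dfn.

Lemma def_omega : def1 (@omega M).
Proof. unfold omega. dfn. Qed.

Hint Resolve def_omega : dfn.

Definition om : M := pick (fun z => forall n, n ∈ z <-> omega n).

Lemma in_om n : n ∈ om <-> omega n.
Proof.
  apply (pick_spec (fun z => forall n, n ∈ z <-> omega n)).
  destruct (infinity M) as [z Hz].
  destruct (comprehension omega z def_omega) as [w Hw]. exists w. intros k.
  rewrite Hw. split; [tauto|]. intros H. split; [|exact H]. apply H, Hz.
Qed.

Lemma omega_emp : omega emp.
Proof.
  intros z [[o [Ho H]] _]. apply is_empty_emp in Ho. subst. exact H.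
Qed.

Lemma omega_succ n : omega n -> omega (succ n).
Proof.
  intros H z Hz. destruct (proj2 Hz n (H z Hz)) as [s [Hs K]].
  apply is_succ_succ in Hs. subst. exact K.
Qed.

(** The part of [om] cut out by [P] is inductive. Definability of [P] makes it a set of the model;
    without it induction could fail at nonstandard numbers. *)
Lemma omega_ind (P : M -> Prop) :
  def1 P -> P emp -> (forall n, omega n -> P n -> P (succ n)) ->
  forall n, omega n -> P n.
Proof.
  intros HP H0 HS n Hn. destruct (comprehension P om HP) as [z Hz].
  apply (Hz n), Hn. split.
  - exists emp. rewrite is_empty_emp, Hz, in_om. auto using omega_emp.
  - intros k Hk. apply Hz in Hk. rewrite in_om in Hk. exists (succ k).
    rewrite is_succ_succ, Hz, in_om. intuition auto using omega_succ.
Qed.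

Lemma emp_neq_one : emp <> succ emp.
Proof.
  intros E. apply (notin_emp emp). rewrite E at 2. apply in_adjoin. auto.
Qed.

(** With [omega n] built in, one comparison certifies that both sides are natural numbers, which
    saves side conditions in the order lemmas. *)
Definition lt m n : Prop := omega n /\ m ∈ n.
Definition le m n : Prop := omega n /\ (m ∈ n \/ m = n).

Lemma def_lt : def2 lt.
Proof. unfold lt. dfn. Qed.

Lemma def_le : def2 le.
Proof. unfold le. dfn. Qed.

Hint Resolve def_lt def_le : dfn.

Lemma omega_mem n : omega n -> forall m, m ∈ n -> omega m.
Proof.
  apply (omega_ind (fun n => forall m, m ∈ n -> omega m)).
  - dfn.
  - intros m H. destruct (notin_emp m H).
  - intros k Hk IH m Hm. apply in_adjoin in Hm. destruct Hm; subst; auto.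
Qed.

Lemma omega_trans n : omega n -> forall m k, m ∈ n -> k ∈ m -> k ∈ n.
Proof.
  apply (omega_ind (fun n => forall m k, m ∈ n -> k ∈ m -> k ∈ n)).
  - dfn.
  - intros m k H. destruct (notin_emp m H).
  - intros l Hl IH m k Hm Hk. apply in_adjoin in Hm. apply in_adjoin. left.
    destruct Hm; subst; eauto.
Qed.

Lemma mem_irrefl x : x ∉ x.
Proof.
  intros H. destruct (foundation M (upair x x)) as [y [Hy K]].
  - exists x. apply in_upair. auto.
  - apply in_upair in Hy. assert (y = x) by tauto. subst.
    apply K. exists x. rewrite in_upair. auto.
Qed.

Lemma lt_omega m n : lt m n -> omega m.
Proof. intros [H K]. exact (omega_mem n H m K). Qed.

Lemma lt_omega_r m n : lt m n -> omega n.
Proof. intros [H _]. exact H. Qed.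

Lemma le_omega m n : le m n -> omega m.
Proof. intros [H [K| ->]]; [exact (omega_mem n H m K)|exact H]. Qed.

Lemma le_omega_r m n : le m n -> omega n.
Proof. intros [H _]. exact H. Qed.

Lemma lt_le m n : lt m n -> le m n.
Proof. intros [H K]. split; auto. Qed.

Lemma le_refl n : omega n -> le n n.
Proof. intros H. split; auto. Qed.

Lemma lt_irrefl n : ~ lt n n.
Proof. intros [_ H]. exact (mem_irrefl n H). Qed.

Lemma lt_le_trans l m n : lt l m -> le m n -> lt l n.
Proof.
  intros [Hm H] [Hn [K| ->]]; split; trivial. exact (omega_trans n Hn m l K H).
Qed.

Lemma le_lt_trans l m n : le l m -> lt m n -> lt l n.
Proof.
  intros [Hm [H| ->]] [Hn K]; split; trivial. exact (omega_trans n Hn m l K H).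
Qed.

Lemma lt_trans l m n : lt l m -> lt m n -> lt l n.
Proof. intros H K. exact (lt_le_trans l m n H (lt_le m n K)). Qed.

Lemma le_trans l m n : le l m -> le m n -> le l n.
Proof.
  intros H [Hn [K| ->]]; trivial. apply lt_le, (le_lt_trans l m); trivial.
  split; trivial.
Qed.

Lemma lt_not_le m n : lt m n -> ~ le n m.
Proof. intros H K. exact (lt_irrefl m (lt_le_trans m n m H K)). Qed.

Lemma le_antisym m n : le m n -> le n m -> m = n.
Proof.
  intros [Hn [H|H]] K; trivial. destruct (lt_not_le m n); trivial.
  split; trivial.
Qed.

Lemma le_lt_succ m n : le m n -> lt m (succ n).
Proof. intros [H K]. split; [apply omega_succ, H|apply in_adjoin, K]. Qed.

Lemma lt_succ n : omega n -> lt n (succ n).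
Proof. intros H. apply le_lt_succ, le_refl, H. Qed.

Lemma emp_le n : omega n -> le emp n.
Proof.
  apply (omega_ind (fun n => le emp n)); [dfn|apply le_refl, omega_emp|].
  intros k Hk H. apply lt_le, le_lt_succ, H.
Qed.

Lemma lt_succ_l m n : lt m n -> le (succ m) n.
Proof.
  intros [Hn H]. revert m H.
  apply (omega_ind (fun n => forall m, m ∈ n -> le (succ m) n)); trivial.
  - dfn.
  - intros m H. destruct (notin_emp m H).
  - intros k Hk IH m H. apply in_adjoin in H. destruct H as [H| ->].
    + apply lt_le, le_lt_succ, IH, H.
    + apply le_refl, omega_succ, Hk.
Qed.

Lemma lt_or_le m n : omega m -> omega n -> lt m n \/ le n m.
Proof.
  intros Hm Hn. revert m Hm.
  apply (omega_ind (fun m => lt m n \/ le n m)).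
  - dfn.
  - destruct (emp_le n Hn) as [_ [H| ->]].
    + left. split; trivial.
    + right. apply le_refl, Hn.
  - intros m Hm [H|H].
    + destruct (lt_succ_l m n H) as [_ [K| ->]].
      * left. split; trivial.
      * right. apply le_refl, Hn.
    + right. apply lt_le, le_lt_succ, H.
Qed.

Lemma upper_bound2 m n : omega m -> omega n -> exists k, le m k /\ le n k.
Proof.
  intros Hm Hn. destruct (lt_or_le m n Hm Hn) as [H|H].
  - exists n. split; [apply lt_le, H|apply le_refl, Hn].
  - exists m. split; [apply le_refl, Hm|exact H].
Qed.

(** Foundation gives a witness that is minimal for membership, and membership is the order. *)
Lemma omega_least (P : M -> Prop) :
  def1 P -> (exists n, omega n /\ P n) ->
  exists n, omega n /\ P n /\ forall m, omega m -> P m -> le n m.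
Proof.
  intros HP [n [Hn Pn]]. destruct (comprehension P om HP) as [z Hz].
  destruct (foundation M z) as [y [Hy K]].
  - exists n. rewrite Hz, in_om. auto.
  - apply Hz in Hy. rewrite in_om in Hy. destruct Hy as [Hy Py].
    exists y. split; [exact Hy|split; [exact Py|]]. intros m Hm Pm.
    destruct (lt_or_le m y Hm Hy) as [[_ H]|H]; trivial.
    destruct K. exists m. rewrite Hz, in_om. auto.
Qed.

Lemma omega_strong_ind (P : M -> Prop) :
  def1 P -> (forall n, omega n -> (forall m, m ∈ n -> P m) -> P n) ->
  forall n, omega n -> P n.
Proof.
  intros HP H n Hn. apply NNPP. intros K.
  destruct (omega_least (fun n => ~ P n)) as [k [Hk [Pk L]]].
  - apply definable_not, HP.
  - exists n. auto.
  - apply Pk, H; trivial. intros m Hm. apply NNPP. intros N.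
    pose proof (L m (omega_mem k Hk m Hm) N) as [_ [G|G]].
    + exact (mem_irrefl k (omega_trans k Hk m k Hm G)).
    + subst. exact (mem_irrefl m Hm).
Qed.

(** A finite maximum inside the model, by internal induction on [n]. It serves wherever finitely
    many bounds are to be replaced by a common one. *)
Lemma uniform_bound (Q : M -> M -> Prop) n :
  def2 Q -> omega n ->
  (forall p b b', Q p b -> le b b' -> Q p b') ->
  (forall p, p ∈ n -> exists b, omega b /\ Q p b) ->
  exists b, omega b /\ forall p, p ∈ n -> Q p b.
Proof.
  intros HQ Hn mono.
  apply (omega_ind (fun n => (forall p, p ∈ n -> exists b, omega b /\ Q p b) ->
    exists b, omega b /\ forall p, p ∈ n -> Q p b)); trivial.
  - dfn.
  - intros _. exists emp. split; [apply omega_emp|].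
    intros p H. destruct (notin_emp p H).
  - intros k Hk IH H. destruct IH as [b [Hb IH]].
    + intros p Hp. apply H, in_adjoin. auto.
    + destruct (H k) as [c [Hc K]]; [apply in_adjoin; auto|].
      destruct (upper_bound2 b c Hb Hc) as [d [Hbd Hcd]].
      exists d. split; [exact (le_omega_r b d Hbd)|].
      intros p Hp. apply in_adjoin in Hp. destruct Hp as [Hp| ->]; eauto.
Qed.

Lemma maps_rel f (P Q : M -> Prop) x y :
  maps f P Q -> rel f x y -> P x /\ Q y.
Proof.
  intros [H _] K. apply rel_pr, H, prodc_pr in K. exact K.
Qed.

Lemma maps_unique f (P Q : M -> Prop) x y y' :
  maps f P Q -> rel f x y -> rel f x y' -> y = y'.
Proof.
  intros H K K'. destruct (maps_rel f P Q x y H K) as [Px _].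
  destruct (proj2 H x Px) as [v [_ L]]. rewrite <- (L y K). exact (L y' K').
Qed.

Lemma maps_total f (P Q : M -> Prop) x :
  maps f P Q -> P x -> exists y, Q y /\ rel f x y.
Proof.
  intros H Px. destruct (proj2 H x Px) as [y [K _]]. exists y.
  split; [exact (proj2 (maps_rel f P Q x y H K))|exact K].
Qed.

Lemma maps_intro f (P Q : M -> Prop) :
  (forall p, p ∈ f -> exists x y, p = pr x y) ->
  (forall x y, rel f x y -> P x /\ Q y) ->
  (forall x, P x -> exists y, rel f x y) ->
  (forall x y y', rel f x y -> rel f x y' -> y = y') ->
  maps f P Q.
Proof.
  intros H1 H2 H3 H4. split.
  - intros p Hp. destruct (H1 p Hp) as [x [y ->]].
    apply prodc_pr, H2, rel_pr, Hp.
  - intros x Px. destruct (H3 x Px) as [y Hy]. exists y. split; [exact Hy|].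
    intros y' Hy'. exact (H4 x y y' Hy Hy').
Qed.

(** The union of all values at [x], which exists for every set [f]. If [f] is a function, the union
    is over a single value and equals it. *)
Definition app f x : M :=
  pick (fun y => forall t, t ∈ y <-> exists v, rel f x v /\ t ∈ v).

Lemma in_app f x t : t ∈ app f x <-> exists v, rel f x v /\ t ∈ v.
Proof.
  apply (pick_spec (fun y => forall t, t ∈ y <-> exists v, rel f x v /\ t ∈ v)).
  (* By the form of Kuratowski pairs, every value of [f] is an element of the double union of
     [f]. *)
  destruct (union M f) as [u Hu]. destruct (union M u) as [v Hv].
  destruct (comprehension (fun w => rel f x w) v) as [w Hw]; [dfn|].
  destruct (union M w) as [z Hz]. exists z. intros s. rewrite Hz.
  split; intros [y [Hy Hs]]; exists y; split; trivial.
  - apply Hw, Hy.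
  - apply Hw. split; [|exact Hy]. apply Hv. exists (upair x y).
    rewrite Hu, in_upair. split; [|auto]. exists (pr x y).
    split; [apply rel_pr, Hy|]. unfold pr. apply in_upair. auto.
Qed.

Lemma dfun_app : dfun2 app.
Proof.
  apply (definable_iff (fun e => forall t,
    t ∈ e 0 <-> exists v, rel (e 1) (e 2) v /\ t ∈ v)); [|dfn].
  intros e. split.
  - intros H. apply extensionality. intros t. rewrite H, in_app. tauto.
  - intros -> t. apply in_app.
Qed.

Hint Resolve dfun_app : dfn.

Lemma rel_app f (P Q : M -> Prop) x y :
  maps f P Q -> rel f x y -> y = app f x.
Proof.
  intros H K. apply extensionality. intros t. rewrite in_app. split.
  - intros Ht. exists y. auto.
  - intros [v [Hv Ht]]. rewrite (maps_unique f P Q x y v H K Hv). exact Ht.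
Qed.

Lemma maps_app f (P Q : M -> Prop) x : maps f P Q -> P x -> rel f x (app f x).
Proof.
  intros H Px. destruct (maps_total f P Q x H Px) as [y [_ K]].
  rewrite <- (rel_app f P Q x y H K). exact K.
Qed.

Lemma app_codomain f (P Q : M -> Prop) x : maps f P Q -> P x -> Q (app f x).
Proof.
  intros H Px. exact (proj2 (maps_rel f P Q _ _ H (maps_app f P Q x H Px))).
Qed.

Lemma product_set a b : exists c, forall t,
  t ∈ c <-> exists x y, x ∈ a /\ y ∈ b /\ t = pr x y.
Proof.
  destruct (binary_union a b) as [u Hu].
  destruct (power_set M u) as [v Hv]. destruct (power_set M v) as [w Hw].
  destruct (comprehension (fun t => exists x y, x ∈ a /\ y ∈ b /\ t = pr x y) w)
    as [c Hc]; [dfn|].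
  exists c. intros t. rewrite Hc. split; [tauto|]. intros H. split; [|exact H].
  destruct H as [x [y [Hx [Hy ->]]]]. apply Hw. intros s Hs. apply Hv.
  intros r Hr. apply Hu. unfold pr in Hs. apply in_upair in Hs.
  destruct Hs; subst; apply in_upair in Hr; destruct Hr; subst; auto.
Qed.

(** The graph is separated from the product of [a] and [b]. Where [G x] has a single solution in
    [b], this turns a definable assignment into a function without choosing values. *)
Lemma function_set a b (G : M -> M -> Prop) :
  def2 G -> (forall x, x ∈ a -> exists y, y ∈ b /\ G x y) ->
  (forall x y y', x ∈ a -> y ∈ b -> y' ∈ b -> G x y -> G x y' -> y = y') ->
  exists f, maps f (elts a) (elts b) /\
    forall x y, rel f x y <-> x ∈ a /\ y ∈ b /\ G x y.
Proof.
  intros HG tot fct. destruct (product_set a b) as [c Hc].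
  destruct (comprehension (fun t => exists x y, G x y /\ t = pr x y) c)
    as [f Hf]; [dfn|].
  assert (K : forall x y, rel f x y <-> x ∈ a /\ y ∈ b /\ G x y).
  { intros x y. rewrite rel_pr, Hf, Hc. split.
    - intros [[x1 [y1 [Hx [Hy H1]]]] [x2 [y2 [H2 H3]]]].
      apply pr_inj in H1, H3. destruct H1, H3. subst. auto.
    - intros [Hx [Hy H]]. split; exists x, y; auto. }
  exists f. split; [|exact K]. apply maps_intro.
  - intros p Hp. apply Hf in Hp. destruct Hp as [_ [x [y [_ H]]]].
    exists x, y. exact H.
  - intros x y H. apply K in H. unfold elts. tauto.
  - intros x Hx. destruct (tot x Hx) as [y Hy]. exists y. apply K. tauto.
  - intros x y y' H H'. apply K in H, H'. apply (fct x); tauto.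
Qed.

End Sets.

#[export] Hint Resolve def_empty def_upair def_pair dfun_adjoin dfun_pr def_rel
  def_succ dfun_succ def_inductive def_omega def_lt def_le dfun_app : dfn.

(** * Finite sets and dependent choice *)

Section Finite.

Context {M : ZF_model}.
Implicit Types a b f i j k n s v x y z : M.

Lemma finite_ext (P Q : M -> Prop) :
  (forall x, P x <-> Q x) -> finite P -> finite Q.
Proof.
  intros H [n [f [Hn [Hf [inj surj]]]]]. exists n, f. split; [exact Hn|].
  split; [|split; [exact inj|intros y Hy; apply surj, H, Hy]].
  destruct Hf as [H1 H2]. split; [|exact H2]. intros p Hp.
  destruct (proj1 (prodc_elim _ _ _) (H1 p Hp)) as [x [y [Hx [Hy ->]]]].
  apply prodc_pr. split; [exact Hx|apply H, Hy].
Qed.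

Lemma finite_empty (P : M -> Prop) : (forall x, ~ P x) -> finite P.
Proof.
  intros H. exists emp, emp. split; [apply omega_emp|].
  assert (K : forall x y, ~ rel (@emp M) x y)
    by (intros x y; rewrite rel_pr; apply notin_emp).
  split; [|split].
  - apply maps_intro.
    + intros p Hp. destruct (notin_emp p Hp).
    + intros x y L. destruct (K x y L).
    + intros x L. destruct (notin_emp x L).
    + intros x y y' L. destruct (K x y L).
  - intros x x' y L. destruct (K x y L).
  - intros y Hy. destruct (H y Hy).
Qed.

Lemma finite_add (P : M -> Prop) a : finite P -> finite (fun x => P x \/ x = a).
Proof.
  intros HP. destruct (classic (P a)) as [Pa|Pa].
  { revert HP. apply finite_ext. intros x. split; [tauto|].
    intros [H| ->]; trivial. }
  destruct HP as [n [f [Hn [Hf [inj surj]]]]].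
  exists (succ n), (adjoin f (pr n a)). split; [apply omega_succ, Hn|].
  assert (K : forall x y,
    rel (adjoin f (pr n a)) x y <-> rel f x y \/ (x = n /\ y = a)).
  { intros x y. rewrite !rel_pr, in_adjoin. split; intros [H|H]; auto.
    - right. apply pr_inj, H.
    - right. destruct H; subst. reflexivity. }
  assert (L : forall y, ~ rel f n y).
  { intros y H. apply (maps_rel _ _ _ _ _ Hf) in H.
    exact (mem_irrefl n (proj1 H)). }
  assert (N : forall x, ~ rel f x a).
  { intros x H. apply (maps_rel _ _ _ _ _ Hf) in H. tauto. }
  split; [apply maps_intro|split].
  - intros p Hp. apply in_adjoin in Hp. destruct Hp as [Hp| ->].
    + destruct (proj1 (prodc_elim _ _ _) (proj1 Hf p Hp))
        as [x [y [_ [_ ->]]]]. exists x, y. reflexivity.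
    + exists n, a. reflexivity.
  - intros x y H. apply K in H. unfold elts.
    unfold succ. rewrite in_adjoin. destruct H as [H|H]; [|tauto].
    apply (maps_rel _ _ _ _ _ Hf) in H. unfold elts in H. tauto.
  - intros x Hx. unfold elts, succ in Hx. apply in_adjoin in Hx.
    destruct Hx as [Hx| ->].
    + destruct (maps_total _ _ _ x Hf Hx) as [y [_ Hy]]. exists y.
      apply K. auto.
    + exists a. apply K. auto.
  - intros x y y' H H'. apply K in H, H'.
    destruct H as [H|[-> ->]], H' as [H'|[H1 ->]]; subst; trivial.
    + exact (maps_unique _ _ _ _ _ _ Hf H H').
    + destruct (L y H).
    + destruct (L y' H').
  - intros x x' y H H'. apply K in H, H'.
    destruct H as [H|[-> ->]], H' as [H'|[-> H1]]; subst; trivial.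
    + eauto.
    + destruct (N x H).
    + destruct (N x' H').
  - intros y [Hy| ->].
    + destruct (surj y Hy) as [x Hx]. exists x. apply K. auto.
    + exists n. apply K. auto.
Qed.

Lemma finite_subset_nat n : omega n ->
  forall a, (forall k, k ∈ a -> k ∈ n) -> finite (elts a).
Proof.
  apply (omega_ind (fun n =>
    forall a, (forall k, k ∈ a -> k ∈ n) -> finite (elts a))).
  - dfn.
  - intros a H. apply finite_empty. intros k Hk. exact (notin_emp k (H k Hk)).
  - intros k Hk IH a H.
    destruct (comprehension (fun x => x ∈ k) a) as [b Hb]; [dfn|].
    assert (Fb : finite (elts b)) by (apply IH; intros l Hl; apply Hb, Hl).
    destruct (classic (k ∈ a)) as [Ka|Ka].
    + apply (finite_add _ k) in Fb. revert Fb. apply finite_ext. intros x.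
      unfold elts. rewrite Hb. split; [intros [L| ->]; tauto|].
      intros Hx. specialize (H x Hx). apply in_adjoin in H. tauto.
    + revert Fb. apply finite_ext. intros x. unfold elts. rewrite Hb.
      split; [tauto|]. intros Hx. split; trivial. specialize (H x Hx).
      apply in_adjoin in H. destruct H; [trivial|subst; tauto].
Qed.

Definition bounded (P : M -> Prop) : Prop :=
  exists b, omega b /\ forall k, P k -> k ∈ b.

Lemma finite_bounded (P : M -> Prop) :
  (forall k, P k -> omega k) -> finite P -> bounded P.
Proof.
  intros HP [n [f [Hn [Hf [_ surj]]]]].
  destruct (uniform_bound (fun i b => omega b /\ app f i ∈ b) n)
    as [b [Hb K]]; trivial.
  - dfn.
  - intros i b b' [Hb H] L. split; [exact (le_omega_r _ _ L)|].
    exact (proj2 (lt_le_trans _ b b' (conj Hb H) L)).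
  - intros i Hi. assert (Pi := app_codomain f _ _ i Hf Hi).
    exists (succ (app f i)). repeat split; try (apply omega_succ; auto).
    apply lt_succ; auto.
  - exists b. split; [exact Hb|]. intros k Pk.
    destruct (surj k Pk) as [i Hi].
    rewrite (rel_app _ _ _ _ _ Hf Hi). apply K.
    exact (proj1 (maps_rel _ _ _ _ _ Hf Hi)).
Qed.

(** For sets of naturals this removes bijections from the definition of finiteness; infinite columns
    and infinite reals are treated in the order form from here on. *)
Lemma finite_iff_bounded (P : M -> Prop) :
  def1 P -> (forall k, P k -> omega k) -> (finite P <-> bounded P).
Proof.
  intros DP HP. split; [apply finite_bounded, HP|]. intros [n [Hn H]].
  destruct (comprehension P n DP) as [a Ha].
  apply (finite_ext (elts a)).
  - intros x. unfold elts. rewrite Ha. split; [tauto|]. auto.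
  - apply (finite_subset_nat n Hn). intros k Hk. apply Ha, Hk.
Qed.

Lemma infinite_omega_iff x : real x ->
  (~ finite (elts x) <-> forall b, omega b -> exists k, k ∈ x /\ le b k).
Proof.
  intros Hx. rewrite (finite_iff_bounded (elts x)); [|unfold elts; dfn|exact Hx].
  split.
  - intros H b Hb. apply NNPP. intros N. apply H. exists b. split; trivial.
    intros k Hk. destruct (lt_or_le k b (Hx k Hk) Hb) as [[_ L]|L]; trivial.
    destruct N. exists k. auto.
  - intros H [b [Hb K]]. destruct (H b Hb) as [k [Hk L]].
    apply (lt_not_le k b); [split; auto|exact L].
Qed.

(** The map may repeat values, so it is no bijection; the image of an initial segment of the domain
    grows by at most one value at each step. *)
Lemma finite_range i (P : M -> Prop) f : omega i -> maps f (elts i) P ->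
  finite (fun y => exists x, rel f x y).
Proof.
  intros Hi Hf.
  assert (K : forall j, omega j -> forall a,
    (forall y, y ∈ a <-> exists x, x ∈ j /\ rel f x y) -> finite (elts a)).
  { apply (omega_ind (fun j => forall a,
      (forall y, y ∈ a <-> exists x, x ∈ j /\ rel f x y) -> finite (elts a))).
    - dfn.
    - intros a H. apply finite_empty. intros y Hy. apply H in Hy.
      destruct Hy as [x [Hx _]]. exact (notin_emp x Hx).
    - intros j Hj IH a H.
      destruct (comprehension (fun y => exists x, x ∈ j /\ rel f x y) a)
        as [b Hb]; [dfn|].
      assert (Fb : finite (elts b)).
      { apply IH. intros y. rewrite Hb, H. split; [tauto|].
        intros [x [Hx L]]. split; exists x; split; trivial.
        apply in_adjoin. auto. }
      destruct (classic (exists y, rel f j y)) as [[w Hw]|N].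
      + apply (finite_add _ w) in Fb. revert Fb. apply finite_ext. intros y.
        unfold elts. rewrite Hb. split.
        * intros [L| ->]; [tauto|]. apply H. exists j.
          split; trivial. apply in_adjoin. auto.
        * intros Hy. pose proof Hy as Hy'. apply H in Hy'.
          destruct Hy' as [x [Hx L]]. apply in_adjoin in Hx.
          destruct Hx as [Hx| ->].
          -- left. split; trivial. exists x. auto.
          -- right. exact (maps_unique _ _ _ _ _ _ Hf L Hw).
      + revert Fb. apply finite_ext. intros y. unfold elts. rewrite Hb.
        split; [tauto|]. intros Hy. split; trivial. apply H in Hy.
        destruct Hy as [x [Hx L]]. apply in_adjoin in Hx.
        destruct Hx as [Hx| ->]; [exists x; auto|].
        destruct N. exists y. exact L. }
  destruct (union M f) as [u Hu]. destruct (union M u) as [w Hw].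
  destruct (comprehension (fun y => exists x, x ∈ i /\ rel f x y) w)
    as [a Ha]; [dfn|].
  assert (Ra : forall y, y ∈ a <-> exists x, x ∈ i /\ rel f x y).
  { intros y. rewrite Ha. split; [tauto|]. intros L. split; trivial.
    destruct L as [x [_ L]]. apply rel_pr in L. apply Hw.
    exists (upair x y). rewrite in_upair, Hu. split; [|auto].
    exists (pr x y). split; trivial. apply in_upair. auto. }
  generalize (K i Hi a Ra). apply finite_ext. intros y. unfold elts.
  rewrite Ra. split; intros [x L]; exists x; [tauto|].
  split; trivial. exact (proj1 (maps_rel _ _ _ _ _ Hf L)).
Qed.

Lemma infinite_avoid i (P : M -> Prop) f : omega i -> ~ finite P ->
  maps f (elts i) P -> exists y, P y /\ forall j, j ∈ i -> app f j <> y.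
Proof.
  intros Hi HP Hf. apply NNPP. intros N. apply HP.
  generalize (finite_range i P f Hi Hf). apply finite_ext. intros y.
  split; [intros [x L]; exact (proj2 (maps_rel _ _ _ _ _ Hf L))|].
  intros Py. apply NNPP. intros K. apply N. exists y. split; trivial.
  intros j Hj <-. apply K. exists j. exact (maps_app _ _ _ _ Hf Hj).
Qed.

(** Dependent choice is applied to finite sequences under one-step extension, and the union of the
    resulting chain is the required sequence. As [Phi] receives the history as a set, the conclusion
    supplies the actual restriction of [t] to [i]. *)
Lemma dependent_choice_history (V : M) (Phi : M -> M -> M -> Prop) :
  dependent_choice M -> def3 Phi ->
  (forall i s, omega i -> maps s (elts i) (elts V) ->
     exists v, v ∈ V /\ Phi i s v) ->
  exists t, maps t omega (elts V) /\
    forall i, omega i -> exists s, maps s (elts i) (elts V) /\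
      (forall j, j ∈ i -> app s j = app t j) /\ Phi i s (app t i).
Proof.
  intros DC DPhi step.
  (* Every earlier value must have been admissible for its own history [r], the restriction of [s]
     to [j]. *)
  set (valid := fun i s => omega i /\ maps s (elts i) (elts V) /\
    forall j, j ∈ i -> exists r, maps r (elts j) (elts V) /\
      (forall l, l ∈ j -> app r l = app s l) /\ Phi j r (app s j)).
  assert (Dvalid : def2 valid).
  { unfold valid. dfn. }
  destruct (product_set om V) as [c Hc]. destruct (power_set M c) as [d Hd].
  destruct (comprehension (fun s => exists i, valid i s) d) as [a Ha]; [dfn|].
  assert (Va : forall i s, valid i s -> s ∈ a).
  { intros i s H. apply Ha. split; [|exists i; exact H]. apply Hd.
    intros p Hp. destruct H as [Hi [[H _] _]]. apply Hc.
    destruct (proj1 (prodc_elim _ _ _) (H p Hp)) as [x [y [Hx [Hy ->]]]].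
    exists x, y. rewrite in_om. repeat split; trivial.
    exact (omega_mem i Hi x Hx). }
  set (extends := fun s s' => exists i v, valid i s /\ Phi i s v /\ v ∈ V /\
    s' = adjoin s (pr i v)).
  assert (Vext : forall s i v, valid i s -> Phi i s v -> v ∈ V ->
    valid (succ i) (adjoin s (pr i v)) /\
    (forall x y, rel (adjoin s (pr i v)) x y <->
       rel s x y \/ (x = i /\ y = v))).
  { intros s i v [Hi [Hs Hh]] Pv Hv.
    assert (K : forall x y, rel (adjoin s (pr i v)) x y <->
      rel s x y \/ (x = i /\ y = v)).
    { intros x y. rewrite !rel_pr, in_adjoin. split; intros [H|H]; auto.
      - right. apply pr_inj, H.
      - right. destruct H; subst. reflexivity. }
    assert (N : forall y, ~ rel s i y).
    { intros y H. apply (maps_rel _ _ _ _ _ Hs) in H.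
      exact (mem_irrefl i (proj1 H)). }
    assert (Hs' : maps (adjoin s (pr i v)) (elts (succ i)) (elts V)).
    { apply maps_intro.
      - intros p Hp. apply in_adjoin in Hp. destruct Hp as [Hp| ->].
        + destruct (proj1 (prodc_elim _ _ _) (proj1 Hs p Hp))
            as [x [y [_ [_ ->]]]]. exists x, y. reflexivity.
        + exists i, v. reflexivity.
      - intros x y H. apply K in H. unfold elts, succ. rewrite in_adjoin.
        destruct H as [H|[-> ->]]; [|tauto].
        apply (maps_rel _ _ _ _ _ Hs) in H. unfold elts in H. tauto.
      - intros x Hx. unfold elts, succ in Hx. apply in_adjoin in Hx.
        destruct Hx as [Hx| ->].
        + exists (app s x). apply K. left. exact (maps_app _ _ _ _ Hs Hx).
        + exists v. apply K. auto.
      - intros x y y' H H'. apply K in H, H'.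
        destruct H as [H|[-> ->]], H' as [H'|[H1 ->]]; subst; trivial.
        + exact (maps_unique _ _ _ _ _ _ Hs H H').
        + destruct (N y H).
        + destruct (N y' H'). }
    assert (A1 : forall l, l ∈ i -> app (adjoin s (pr i v)) l = app s l).
    { intros l Hl. symmetry. apply (rel_app _ _ _ _ _ Hs'). apply K. left.
      exact (maps_app _ _ _ _ Hs Hl). }
    assert (A2 : v = app (adjoin s (pr i v)) i)
      by (apply (rel_app _ _ _ _ _ Hs'); apply K; auto).
    split; [|exact K]. split; [apply omega_succ, Hi|split; [exact Hs'|]].
    intros j Hj. apply in_adjoin in Hj. destruct Hj as [Hj| ->].
    - destruct (Hh j Hj) as [r [Hr [E P]]]. exists r. split; [exact Hr|].
      rewrite A1 by exact Hj. split; [|exact P]. intros l Hl.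
      rewrite A1; [apply E, Hl|]. exact (omega_trans i Hi j l Hj Hl).
    - exists s. split; [exact Hs|]. rewrite <- A2. split; [|exact Pv].
      intros l Hl. symmetry. apply A1, Hl. }
  destruct (product_set a a) as [aa Haa].
  destruct (comprehension (fun p => exists s s', extends s s' /\ p = pr s s')
    aa) as [r Hr]; [unfold extends; dfn|].
  assert (Rr : forall s s', rel r s s' <-> s ∈ a /\ s' ∈ a /\ extends s s').
  { intros s s'. rewrite rel_pr, Hr, Haa. split.
    - intros [[x [x' [Hx [Hx' E]]]] [y [y' [Hy E']]]].
      apply pr_inj in E, E'. destruct E, E'. subst. auto.
    - intros [Hx [Hx' E]]. split; exists s, s'; auto. }
  destruct (DC a r) as [f [Hf Hstep]].
  - exists emp. apply (Va emp). split; [apply omega_emp|]. split.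
    + apply maps_intro.
      * intros p Hp. destruct (notin_emp p Hp).
      * intros x y H. destruct (notin_emp _ (proj1 (rel_pr _ _ _) H)).
      * intros x H. destruct (notin_emp x H).
      * intros x y y' H. destruct (notin_emp _ (proj1 (rel_pr _ _ _) H)).
    + intros j H. destruct (notin_emp j H).
  - intros p Hp. apply Hr in Hp. destruct Hp as [Hp _]. apply Haa in Hp.
    apply prodc_elim. exact Hp.
  - intros s Hs. pose proof Hs as Hs'. apply Ha in Hs'.
    destruct Hs' as [_ [i Hi]]. destruct (step i s) as [v [Hv Pv]].
    1,2: apply Hi.
    destruct (Vext s i v Hi Pv Hv) as [K _].
    exists (adjoin s (pr i v)). split; [exact (Va _ _ K)|]. apply Rr.
    split; [exact Hs|split; [exact (Va _ _ K)|]]. exists i, v. auto.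
  - assert (Fa : forall n, omega n -> exists i, valid i (app f n)).
    { intros n Hn. pose proof (app_codomain _ _ _ _ Hf Hn) as K.
      apply Ha in K. apply K. }
    assert (Fe : forall n, omega n -> extends (app f n) (app f (succ n))).
    { intros n Hn. apply Rr. apply (Hstep n (succ n)); trivial.
      - apply is_succ_succ. reflexivity.
      - exact (maps_app _ _ _ _ Hf Hn).
      - exact (maps_app _ _ _ _ Hf (omega_succ n Hn)). }
    assert (mono : forall n, omega n -> forall m, m ∈ n ->
      forall x y, rel (app f m) x y -> rel (app f n) x y).
    { apply (omega_ind (fun n => forall m, m ∈ n ->
        forall x y, rel (app f m) x y -> rel (app f n) x y)); [dfn|..].
      - intros m H. destruct (notin_emp m H).
      - intros n Hn IH m Hm x y L. apply in_adjoin in Hm.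
        destruct (Fe n Hn) as [i [v [Vi [Pv [Hv ->]]]]].
        apply (Vext _ i v Vi Pv Hv). left.
        destruct Hm as [Hm| ->]; eauto. }
    (* The principle does not fix its first term, so the length at a given stage is unknown; each
       step adds one place, which suffices to reach every [i]. *)
    assert (dom : forall i, omega i ->
      exists n y, omega n /\ rel (app f n) i y).
    { apply (omega_ind (fun i => exists n y, omega n /\ rel (app f n) i y));
        [dfn|..].
      - destruct (Fe emp omega_emp) as [i [v [Vi [Pv [Hv E]]]]].
        destruct (Vext _ i v Vi Pv Hv) as [K _]. rewrite <- E in K.
        destruct K as [_ [K _]].
        exists (succ emp), (app (app f (succ emp)) emp).
        split; [apply omega_succ, omega_emp|].
        apply (maps_app _ _ _ _ K). apply le_lt_succ, emp_le, Vi.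
      - intros i Hi [n [y [Hn L]]].
        destruct (Fe n Hn) as [j [v [Vj [Pv [Hv E]]]]].
        assert (Hj : lt i j).
        { split; [apply Vj|]. destruct Vj as [_ [Vj _]].
          exact (proj1 (maps_rel _ _ _ _ _ Vj L)). }
        destruct (Vext _ j v Vj Pv Hv) as [K _]. rewrite <- E in K.
        destruct K as [_ [K _]].
        exists (succ n), (app (app f (succ n)) (succ i)).
        split; [apply omega_succ, Hn|].
        apply (maps_app _ _ _ _ K). apply le_lt_succ, lt_succ_l, Hj. }
    destruct (comprehension (fun p => exists n, omega n /\ p ∈ app f n) c)
      as [t Ht]; [dfn|].
    assert (Rt : forall x y, rel t x y <-> exists n, omega n /\ rel (app f n) x y).
    { intros x y. rewrite rel_pr, Ht. split.
      - intros [_ [n [Hn L]]]. exists n. rewrite rel_pr. auto.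
      - intros [n [Hn L]]. split; [|exists n; rewrite <- rel_pr; auto].
        destruct (Fa n Hn) as [i Vi]. apply Hc. exists x, y.
        destruct Vi as [Hi [Vi _]]. apply (maps_rel _ _ _ _ _ Vi) in L.
        rewrite in_om. unfold elts in L. split; [|tauto].
        exact (omega_mem i Hi x (proj1 L)). }
    assert (Mt : maps t omega (elts V)).
    { apply maps_intro.
      - intros p Hp. apply Ht in Hp. destruct Hp as [Hp _]. apply Hc in Hp.
        destruct Hp as [x [y [_ [_ ->]]]]. exists x, y. reflexivity.
      - intros x y L. apply rel_pr, Ht in L. destruct L as [L _].
        apply Hc in L. destruct L as [x' [y' [Hx [Hy E]]]].
        apply pr_inj in E. destruct E; subst. rewrite in_om in Hx. auto.
      - intros i Hi. destruct (dom i Hi) as [n [y L]]. exists y.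
        apply Rt. exists n. exact L.
      - intros x y y' L L'. apply Rt in L, L'.
        destruct L as [n [Hn L]], L' as [n' [Hn' L']].
        destruct (upper_bound2 n n' Hn Hn') as [k [[Hk K] [_ K']]].
        assert (L1 : rel (app f k) x y) by (destruct K; subst; eauto).
        assert (L2 : rel (app f k) x y') by (destruct K'; subst; eauto).
        destruct (Fa k Hk) as [i [_ [Vi _]]].
        exact (maps_unique _ _ _ _ _ _ Vi L1 L2). }
    exists t. split; [exact Mt|]. intros i Hi.
    destruct (dom i Hi) as [n [y [Hn L]]].
    destruct (Fa n Hn) as [j [Hj [Vj Hh]]].
    assert (At : forall l, l ∈ j -> app (app f n) l = app t l).
    { intros l Hl. apply (rel_app _ _ _ _ _ Mt), Rt. exists n.
      split; [exact Hn|]. exact (maps_app _ _ _ _ Vj Hl). }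
    assert (ij : i ∈ j) by exact (proj1 (maps_rel _ _ _ _ _ Vj L)).
    destruct (Hh i ij) as [s [Hs [E P]]]. exists s. split; [exact Hs|].
    rewrite <- At by exact ij. split; [|exact P].
    intros l Hl. rewrite E, At; trivial. exact (omega_trans j Hj i l ij Hl).
Qed.

End Finite.

(** * The ideal Fin x Fin and block sequences *)

Section Ideal.

Context {M : ZF_model}.
Implicit Types F X Y b h k m n t y : M.

(** Positivity for Fin x Fin, stated without finiteness so that columns and points can be picked
    from it directly. *)
Definition wide (P : M -> Prop) : Prop :=
  forall n, omega n -> exists k, le n k /\
    forall b, omega b -> exists m, le b m /\ P (pr k m).

Lemma wide_iff (P : M -> Prop) : def1 P ->
  (forall p, P p -> prodc omega omega p) -> (wide P <-> ~ fin_fin P).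
Proof.
  intros DP HP. unfold fin_fin.
  assert (K : forall n, ~ finite (fun m => omega m /\ exists p, is_pair p n m /\ P p)
    <-> forall b, omega b -> exists m, le b m /\ P (pr n m)).
  { intros n. rewrite finite_iff_bounded; [|dfn|tauto]. split.
    - intros H b Hb. apply NNPP. intros N. apply H. exists b.
      split; trivial. intros k [Hk [p [Hp Pk]]].
      destruct (lt_or_le k b Hk Hb) as [[_ L]|L]; trivial.
      destruct N. exists k. apply is_pair_pr in Hp. subst. auto.
    - intros H [b [Hb Kb]]. destruct (H b Hb) as [m [L Pm]].
      apply (lt_not_le m b); [|exact L]. split; trivial. apply Kb.
      split; [exact (le_omega_r _ _ L)|]. exists (pr n m).
      rewrite is_pair_pr. auto. }
  rewrite finite_iff_bounded; [|dfn|tauto]. split.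
  - intros H [_ [n [Hn Kn]]]. destruct (H n Hn) as [k [L Hk]].
    apply (lt_not_le k n); [|exact L]. split; trivial. apply Kn.
    split; [exact (le_omega_r _ _ L)|]. apply K, Hk.
  - intros H n Hn. apply NNPP. intros N. apply H. split; [exact HP|].
    exists n. split; trivial. intros k [Hk Ik].
    destruct (lt_or_le k n Hk Hn) as [[_ L]|L]; trivial.
    destruct N. exists k. split; trivial. apply K, Ik.
Qed.

Lemma mad_wide F y : fin_fin_mad F -> y ∈ F -> wide (elts y).
Proof.
  intros [[H _] _] Hy. destruct (H y Hy) as [Sy Wy].
  apply wide_iff; trivial. unfold elts. dfn.
Qed.

Lemma mad_disjoint F y y' : fin_fin_mad F -> y ∈ F -> y' ∈ F ->
  wide (fun p => p ∈ y /\ p ∈ y') -> y = y'.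
Proof.
  intros [[H K] _] Hy Hy' W. apply NNPP. intros N.
  apply (wide_iff _) in W; [exact (W (K y y' Hy Hy' N))|dfn|].
  intros p [Hp _]. exact (proj1 (H y Hy) p Hp).
Qed.

Lemma wide_ext (P Q : M -> Prop) : (forall p, P p -> Q p) -> wide P -> wide Q.
Proof.
  intros H W n Hn. destruct (W n Hn) as [k [L K]]. exists k. split; trivial.
  intros b Hb. destruct (K b Hb) as [m [Lm Pm]]. exists m. auto.
Qed.

(** Otherwise adjoining [h] would give a larger almost disjoint family. *)
Lemma mad_meets F h : fin_fin_mad F ->
  (forall p, p ∈ h -> prodc omega omega p) -> wide (elts h) ->
  exists y, y ∈ F /\ wide (fun p => p ∈ y /\ p ∈ h).
Proof.
  intros HF Sh Wh. apply NNPP. intros N. pose proof HF as [[H1 H2] max].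
  assert (Nh : h ∉ F).
  { intros K. apply N. exists h. split; trivial.
    revert Wh. apply wide_ext. unfold elts. auto. }
  apply Nh. rewrite <- (max (adjoin F h)); [apply in_adjoin; auto| |].
  - assert (K : forall y, y ∈ F -> fin_fin (fun p => p ∈ y /\ p ∈ h)).
    { intros y Hy. apply NNPP. intros L. apply N. exists y. split; trivial.
      apply wide_iff; trivial; [dfn|]. intros p [_ Hp]. apply Sh, Hp. }
    split.
    + intros y Hy. apply in_adjoin in Hy. destruct Hy as [Hy| ->]; auto.
      split; trivial. apply wide_iff; trivial. unfold elts. dfn.
    + intros y y' Hy Hy' D. apply in_adjoin in Hy, Hy'.
      destruct Hy as [Hy| ->], Hy' as [Hy'| ->]; auto; [|tauto].
      destruct (K y' Hy') as [L1 L2]. split; [intros p Hp; apply L1; tauto|].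
      revert L2. apply finite_ext. intros n.
      (* Almost disjointness is demanded for ordered pairs; here the new member comes first, so the
         conjuncts change places. *)
      assert (E : finite (fun m => omega m /\ exists p, is_pair p n m /\ p ∈ y' /\ p ∈ h)
        <-> finite (fun m => omega m /\ exists p, is_pair p n m /\ p ∈ h /\ p ∈ y')).
      { split; apply finite_ext; intros m; split; intros [Hm [p Hp]];
          (split; [exact Hm|exists p; tauto]). }
      tauto.
  - intros y Hy. apply in_adjoin. auto.
Qed.

End Ideal.

(** * Block sequences: recovering them from a set of numbers, and constructing them *)

Section Blocks.

Context {M : ZF_model}.
Implicit Types B b i j k l m n p q r s t x y z : M.

Definition blk s i p q r : Prop := rel s i (pr p (pr q r)).

Lemma def_blk : def5 blk.
Proof. unfold blk. dfn. Qed.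

Hint Resolve def_blk : dfn.

(* A sequence of consecutive blocks p_i < q_i < r_i of natural numbers. *)
Definition blockseq s : Prop :=
  (forall i, omega i -> exists p q r, blk s i p q r) /\
  (forall i x x', rel s i x -> rel s i x' -> x = x') /\
  (forall i p q r, blk s i p q r -> lt p q /\ lt q r) /\
  (forall i j p q r p' q' r', lt i j -> blk s i p q r -> blk s j p' q' r' ->
     lt r p').

Lemma def_blockseq : def1 blockseq.
Proof. unfold blockseq. dfn. Qed.

Hint Resolve def_blockseq : dfn.

Definition listed s i m : Prop :=
  exists j p q r, le j i /\ blk s j p q r /\ (m = p \/ m = q \/ m = r).

Lemma def_listed : def3 listed.
Proof. unfold listed. dfn. Qed.

Hint Resolve def_listed : dfn.

(* The blocks up to [i] enumerate an initial segment of [z]. *)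
Definition init s i z : Prop :=
  omega i /\ forall p q r, blk s i p q r ->
    forall m, le m r -> (m ∈ z <-> listed s i m).

Lemma def_init : def3 init.
Proof. unfold init. dfn. Qed.

Hint Resolve def_init : dfn.

Definition range s z : Prop := forall m, m ∈ z <-> exists i, omega i /\ listed s i m.

Lemma blk_inj s i p q r p' q' r' : blockseq s ->
  blk s i p q r -> blk s i p' q' r' -> p = p' /\ q = q' /\ r = r'.
Proof.
  intros [_ [H _]] K K'. specialize (H _ _ _ K K').
  apply pr_inj in H. destruct H as [-> H]. apply pr_inj in H. tauto.
Qed.

Lemma block_bounds s i j p q r p' q' r' m : blockseq s ->
  blk s i p q r -> blk s j p' q' r' -> le i j -> m = p' \/ m = q' \/ m = r' ->
  le p m.
Proof.
  intros Hs Hi Hj L Hm. pose proof Hs as [_ [_ [inc sep]]].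
  destruct (inc _ _ _ _ Hi) as [H1 H2]. destruct (inc _ _ _ _ Hj) as [H3 H4].
  assert (K : le p p').
  { destruct L as [Jo [L| ->]].
    - assert (lt r p') by (apply (sep i j p q r p' q' r'); trivial; split; trivial).
      eauto 6 using lt_le, lt_trans.
    - destruct (blk_inj _ _ _ _ _ _ _ _ Hs Hi Hj) as [-> _].
      exact (le_refl _ (lt_omega _ _ H3)). }
  destruct Hm as [-> |[-> | ->]]; eauto 6 using le_trans, lt_le.
Qed.

Lemma block_le_last s i j p q r p' q' r' m : blockseq s ->
  blk s i p q r -> blk s j p' q' r' -> le j i -> m = p' \/ m = q' \/ m = r' ->
  le m r.
Proof.
  intros Hs Hi Hj L Hm. pose proof Hs as [_ [_ [inc sep]]].
  destruct (inc _ _ _ _ Hi) as [H1 H2]. destruct (inc _ _ _ _ Hj) as [H3 H4].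
  assert (K : le r' r).
  { destruct L as [Jo [L| ->]].
    - assert (lt r' p) by (apply (sep j i p' q' r' p q r); trivial; split; trivial).
      eauto 6 using lt_le, lt_trans.
    - destruct (blk_inj _ _ _ _ _ _ _ _ Hs Hi Hj) as [_ [_ ->]].
      exact (le_refl _ (lt_omega_r _ _ H4)). }
  destruct Hm as [-> |[-> | ->]]; eauto 6 using le_trans, lt_le.
Qed.

Lemma range_init s z i : blockseq s -> range s z -> omega i -> init s i z.
Proof.
  intros Hs Hz Hi. split; [exact Hi|]. intros p q r Hb m L.
  rewrite (Hz m). split; [|intros K; exists i; auto].
  intros [i' [_ [j [p' [q' [r' [Lj [Hj Hm]]]]]]]].
  destruct (lt_or_le i j Hi (le_omega _ _ Lj)) as [K|K].
  - pose proof (proj2 (proj2 (proj2 Hs)) _ _ _ _ _ _ _ _ K Hb Hj) as N.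
    pose proof (block_bounds s j j p' q' r' p' q' r' m Hs Hj Hj
      (le_refl _ (le_omega _ _ Lj)) Hm) as N'.
    destruct (lt_not_le r p' N). exact (le_trans _ _ _ N' L).
  - exists j, p', q', r'. auto.
Qed.

(** This recovers the blocks from [z]: [p] is the least element above all earlier blocks, [q] the
    next one, [r] the one after. Knowing [z] up to the end of block [i] is enough, since elements
    beyond it are larger anyway. *)
Lemma block_least s i j z p q r : blockseq s -> init s i z -> le j i ->
  (forall m, m ∈ z -> omega m) -> blk s j p q r ->
  (p ∈ z /\ forall m, m ∈ z ->
     (forall l pl ql rl, lt l j -> blk s l pl ql rl -> lt rl m) -> le p m) /\
  (q ∈ z /\ forall m, m ∈ z -> lt p m -> le q m) /\
  (r ∈ z /\ forall m, m ∈ z -> lt q m -> le r m).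
Proof.
  intros Hs [Hi Hz] L Rz Hj. pose proof Hs as [tot [_ [inc sep]]].
  destruct (tot i Hi) as [pi [qi [ri Bi]]]. specialize (Hz _ _ _ Bi).
  destruct (inc _ _ _ _ Hj) as [pq qr].
  assert (Z : forall m, m = p \/ m = q \/ m = r -> m ∈ z /\ le m ri).
  { intros m Hm.
    assert (K : le m ri) by exact (block_le_last s i j _ _ _ _ _ _ m Hs Bi Hj L Hm).
    split; trivial. apply Hz; trivial. exists j, p, q, r. auto. }
  (* an element of [z] not above block [j] lies in a block up to [i] *)
  assert (C : forall m, m ∈ z ->
    lt r m \/ (exists l pl ql rl, lt l j /\ blk s l pl ql rl /\ le m rl) \/
    m = p \/ m = q \/ m = r).
  { intros m Hm. destruct (lt_or_le ri m) as [K|K];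
      [exact (le_omega_r _ _ (proj2 (Z p (or_introl eq_refl))))|exact (Rz m Hm)| |].
    - left. apply (le_lt_trans _ ri); trivial.
      apply (block_le_last s i j _ _ _ _ _ _ r Hs Bi Hj L). auto.
    - apply Hz in Hm; trivial.
      destruct Hm as [l [pl [ql [rl [Ll [Hl E]]]]]].
      destruct (lt_or_le l j (le_omega _ _ Ll) (le_omega _ _ L)) as [N|N].
      + right. left. exists l, pl, ql, rl. split; [exact N|split; [exact Hl|]].
        exact (block_le_last s l l _ _ _ _ _ _ m Hs Hl Hl
          (le_refl _ (le_omega _ _ Ll)) E).
      + destruct N as [_ [N|N]].
        * left. apply (lt_le_trans _ pl).
          -- apply (sep j l p q r pl ql rl); trivial.
             split; [exact (le_omega _ _ Ll)|exact N].
          -- exact (block_bounds s l l _ _ _ _ _ _ m Hs Hl Hl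
               (le_refl _ (le_omega _ _ Ll)) E).
        * subst. destruct (blk_inj _ _ _ _ _ _ _ _ Hs Hj Hl) as [-> [-> ->]].
          auto. }
  assert (D : forall m l pl ql rl, lt l j -> blk s l pl ql rl -> le m rl ->
    lt m p) by eauto using le_lt_trans.
  assert (T1 : forall m, lt r m -> lt q m) by (intros m; apply lt_trans, qr).
  assert (T2 : forall m, lt q m -> lt p m) by (intros m; apply lt_trans, pq).
  split; [|split]; (split; [apply Z; auto|]); intros m Hm G;
    destruct (C m Hm) as [K|[[l [pl [ql [rl [K1 [K2 K3]]]]]]|[->|[->| ->]]]];
    try (apply le_refl, Rz, Hm); try solve [auto using lt_le].
  - destruct (lt_not_le rl m); eauto.
  - destruct (lt_irrefl m). eauto using lt_trans.
  - destruct (lt_irrefl p); trivial.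
  - destruct (lt_irrefl m). eauto using lt_trans.
  - destruct (lt_irrefl p). eauto using lt_trans.
  - destruct (lt_irrefl q); trivial.
Qed.

(** Once the earlier blocks agree, minimality determines [p], [q] and [r]. Only one of the sequences
    is assumed to list all of [z], because a witness for [decode] describes no more than an initial
    segment. *)
Lemma blocks_unique s s' z i : blockseq s -> blockseq s' -> range s z ->
  (forall m, m ∈ z -> omega m) -> init s' i z ->
  forall j, omega j -> le j i -> forall p q r, blk s' j p q r -> blk s j p q r.
Proof.
  intros Hs Hs' Rz Oz Ii.
  apply (omega_strong_ind (fun j =>
    le j i -> forall p q r, blk s' j p q r -> blk s j p q r)); [dfn|].
  intros j Hj IH L p q r B'. destruct (proj1 Hs j Hj) as [p0 [q0 [r0 B0]]].
  assert (IH' : forall l, lt l j -> forall pl ql rl,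
    blk s l pl ql rl <-> blk s' l pl ql rl).
  { intros l Hl.
    assert (Ll : le l i) by (apply (le_trans _ j); [apply lt_le|]; trivial).
    assert (K := fun pl ql rl => IH l (proj2 Hl) Ll pl ql rl).
    intros pl ql rl. split; auto. intros N.
    destruct (proj1 Hs' l (lt_omega _ _ Hl)) as [p1 [q1 [r1 B1]]].
    destruct (blk_inj _ _ _ _ _ _ _ _ Hs N (K _ _ _ B1)) as [-> [-> ->]].
    exact B1. }
  destruct (block_least s' i j z p q r Hs' Ii L Oz B')
    as [[P1 P2] [[Q1 Q2] [R1 R2]]].
  destruct (block_least s j j z p0 q0 r0 Hs (range_init s z j Hs Rz Hj)
    (le_refl j Hj) Oz B0) as [[P3 P4] [[Q3 Q4] [R3 R4]]].
  destruct (proj1 (proj2 (proj2 Hs)) _ _ _ _ B0) as [H1 H2].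
  destruct (proj1 (proj2 (proj2 Hs')) _ _ _ _ B') as [H3 H4].
  assert (p = p0).
  { apply le_antisym.
    - apply P2; trivial. intros l pl ql rl Hl Bl.
      apply (proj2 (proj2 (proj2 Hs)) l j pl ql rl p0 q0 r0); trivial.
      apply IH'; trivial.
    - apply P4; trivial. intros l pl ql rl Hl Bl.
      apply (proj2 (proj2 (proj2 Hs')) l j pl ql rl p q r); trivial.
      apply IH'; trivial. }
  subst p0.
  assert (q = q0) by (apply le_antisym; auto). subst q0.
  assert (r = r0) by (apply le_antisym; auto). subst r0. exact B0.
Qed.

(** Forces the columns of late blocks far to the right, and the points they add high up. *)
Lemma block_growth s : blockseq s ->
  forall i, omega i -> forall p q r, blk s i p q r -> le i p.
Proof.
  intros Hs. pose proof Hs as [tot [_ [inc sep]]].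
  apply (omega_ind (fun i => forall p q r, blk s i p q r -> le i p)); [dfn|..].
  - intros p q r K. apply emp_le. exact (lt_omega _ _ (proj1 (inc _ _ _ _ K))).
  - intros i Hi IH p' q' r' K. destruct (tot i Hi) as [p [q [r B]]].
    apply lt_succ_l. apply (le_lt_trans _ p); [eauto|].
    destruct (inc _ _ _ _ B). apply (lt_trans _ q); trivial.
    apply (lt_trans _ r); trivial.
    apply (sep i (succ i) p q r p' q' r'); trivial. apply lt_succ, Hi.
Qed.

(** One construction for both halves of the Ramsey argument. [G0] and [G1] restrict the pairs of the
    first and of the later blocks; [R] is what the last entry of block [i] must achieve for the
    column of the earlier block [j] that [e] assigns to [i]. *)
Lemma block_selection e B (G0 G1 : M -> M -> Prop) (R : M -> M -> M -> Prop) :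
  dependent_choice M -> bijection e (prodc omega omega) omega ->
  def2 G0 -> def2 G1 -> def3 R ->
  (forall m, m ∈ B -> omega m) ->
  (forall p q, G0 p q \/ G1 p q -> p ∈ B /\ q ∈ B /\ lt p q) ->
  (forall p q, G0 p q \/ G1 p q ->
     forall b, omega b -> exists r, le b r /\ r ∈ B /\ R p q r) ->
  (exists p q, G0 p q) ->
  (forall n, omega n -> exists p q, le n p /\ G1 p q) ->
  exists s, blockseq s /\
    (forall i p q r, blk s i p q r -> omega i /\ p ∈ B /\ q ∈ B /\ r ∈ B) /\
    (forall p q r, blk s emp p q r -> G0 p q) /\
    (forall i p q r, lt emp i -> blk s i p q r -> G1 p q) /\
    (forall j i l p q r p' q' r', lt j i -> rel e (pr j l) i ->
       blk s j p q r -> blk s i p' q' r' -> R p q r').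
Proof.
  intros DC He D0 D1 DR OB HG HR [p0 [q0 K0]] K1.
  destruct (product_set B B) as [BB HBB].
  destruct (product_set B BB) as [BBB HBBB].
  destruct (comprehension (fun v => exists p q r, v = pr p (pr q r) /\
    (G0 p q \/ G1 p q) /\ lt q r) BBB) as [V HV]; [dfn|].
  assert (TV : forall p q r, pr p (pr q r) ∈ V <->
    p ∈ B /\ q ∈ B /\ r ∈ B /\ (G0 p q \/ G1 p q) /\ lt p q /\ lt q r).
  { intros p q r. rewrite HV, HBBB. split.
    - intros [[x [y [Hx [Hy E]]]] [p1 [q1 [r1 [E1 [G L]]]]]].
      apply pr_inj in E1. destruct E1 as [-> E1]. apply pr_inj in E1.
      destruct E1 as [-> ->]. apply pr_inj in E. destruct E as [-> E].
      subst y. apply HBB in Hy. destruct Hy as [u [w [Hu [Hw E]]]].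
      apply pr_inj in E. destruct E; subst. pose proof (HG _ _ G). tauto.
    - intros [Hp [Hq [Hr [G [L L']]]]]. split.
      + exists p, (pr q r). rewrite HBB. split; trivial. split; trivial.
        exists q, r. auto.
      + exists p, q, r. auto. }
  destruct (dependent_choice_history V (fun i s v => exists p q r,
     v = pr p (pr q r) /\ (i = emp -> G0 p q) /\ (i <> emp -> G1 p q) /\
     (forall j pj qj rj, j ∈ i -> app s j = pr pj (pr qj rj) -> lt rj p) /\
     (forall j l pj qj rj, j ∈ i -> rel e (pr j l) i ->
        app s j = pr pj (pr qj rj) -> R pj qj r)) DC) as [s [Ms Hs]].
  - dfn.
  - intros i s Hi Ms.
    assert (Vs : forall j, j ∈ i -> app s j ∈ V)
      by (intros j Hj; exact (app_codomain _ _ _ _ Ms Hj)).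
    assert (Ub : exists b, omega b /\ forall j, j ∈ i ->
      omega b /\ forall pj qj rj, app s j = pr pj (pr qj rj) -> lt rj b).
    { apply (uniform_bound (fun j b => omega b /\ forall pj qj rj,
        app s j = pr pj (pr qj rj) -> lt rj b)); trivial; [dfn| |].
      - intros j b b' [Hb H] L. split; [exact (le_omega_r _ _ L)|].
        eauto using lt_le_trans.
      - intros j Hj. pose proof (Vs j Hj) as Vj. pose proof Vj as Vj'.
        apply HV in Vj'. destruct Vj' as [_ [p [q [r [E [_ L]]]]]].
        exists (succ r). pose proof (lt_omega_r _ _ L) as Or.
        repeat split; try (apply omega_succ; trivial).
        intros. rewrite E in H. apply pr_inj in H. destruct H as [_ H].
        apply pr_inj in H. destruct H as [_ <-]. apply lt_succ, Or. }
    destruct Ub as [b [Hb Ub]].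
    (* [G0] promises no large pairs, but the first block has no predecessor to exceed, so the bound
       [b] is required of later blocks only. *)
    assert (Pq : exists p q, (i = emp -> G0 p q) /\ (i <> emp -> G1 p q) /\
      (i <> emp -> le b p)).
    { destruct (classic (i = emp)) as [E|E].
      - exists p0, q0. tauto.
      - destruct (K1 b Hb) as [p [q [L G]]]. exists p, q. tauto. }
    destruct Pq as [p [q [Q0 [Q1 Qb]]]].
    assert (Gpq : G0 p q \/ G1 p q) by (destruct (classic (i = emp)); auto).
    assert (lt p q) as Lpq by apply (HG p q Gpq).
    assert (Rr : exists r, lt q r /\ r ∈ B /\
      forall j l pj qj rj, j ∈ i -> rel e (pr j l) i ->
        app s j = pr pj (pr qj rj) -> R pj qj r).
    { pose proof (lt_omega_r _ _ Lpq) as Oq.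
      (* Since [e] is injective, at most one earlier [j] is assigned to [i], so [r] has to meet a
         single requirement. *)
      destruct (classic (exists j l, j ∈ i /\ rel e (pr j l) i))
        as [[j [l [Hj El]]]|N].
      - pose proof (Vs j Hj) as Vj. pose proof Vj as Vj'. apply HV in Vj'.
        destruct Vj' as [_ [pj [qj [rj [E [Gj _]]]]]].
        destruct (HR pj qj Gj (succ q) (omega_succ _ Oq)) as [r [L [Br Rj]]].
        exists r. split; [exact (lt_le_trans _ _ _ (lt_succ q Oq) L)|].
        split; [exact Br|]. intros j' l' pj' qj' rj' Hj' El' E'.
        pose proof (proj1 (proj2 He) _ _ _ El El') as U.
        apply pr_inj in U. destruct U as [-> _]. rewrite E in E'.
        apply pr_inj in E'. destruct E' as [<- E']. apply pr_inj in E'.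
        destruct E' as [<- _]. exact Rj.
      (* No block is assigned to [i]: [HR] serves as a source of elements of [B] above [q]. *)
      - destruct (HR p q Gpq (succ q) (omega_succ _ Oq)) as [r [L [Br _]]].
        exists r. split; [exact (lt_le_trans _ _ _ (lt_succ q Oq) L)|].
        split; [exact Br|]. intros j l pj qj rj Hj El. destruct N.
        exists j, l. auto. }
    destruct Rr as [r [Lqr [Br Rr]]].
    exists (pr p (pr q r)). split.
    + apply TV. pose proof (HG p q Gpq). tauto.
    + exists p, q, r. split; [reflexivity|]. split; [exact Q0|].
      split; [exact Q1|]. split; [|exact Rr].
      intros j pj qj rj Hj E. apply (lt_le_trans _ b).
      * exact (proj2 (Ub j Hj) _ _ _ E).
      * apply Qb. intros ->. exact (notin_emp j Hj).
  - assert (Bs : forall i p q r, blk s i p q r <->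
      omega i /\ app s i = pr p (pr q r)).
    { intros i p q r. unfold blk. split.
      - intros H. split; [exact (proj1 (maps_rel _ _ _ _ _ Ms H))|].
        symmetry. exact (rel_app _ _ _ _ _ Ms H).
      - intros [Hi <-]. exact (maps_app _ _ _ _ Ms Hi). }
    assert (St : forall i p q r, blk s i p q r ->
      (i = emp -> G0 p q) /\ (i <> emp -> G1 p q) /\
      (forall j pj qj rj, j ∈ i -> app s j = pr pj (pr qj rj) -> lt rj p) /\
      (forall j l pj qj rj, j ∈ i -> rel e (pr j l) i ->
         app s j = pr pj (pr qj rj) -> R pj qj r)).
    { intros i p q r H. apply Bs in H. destruct H as [Hi E].
      destruct (Hs i Hi) as [s' [_ [As [p1 [q1 [r1 [E1 [A1 [A2 [A3 A4]]]]]]]]]].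
      rewrite E in E1. apply pr_inj in E1. destruct E1 as [<- E1].
      apply pr_inj in E1. destruct E1 as [<- <-].
      split; [exact A1|split; [exact A2|split]].
      - intros j pj qj rj Hj. rewrite <- As by exact Hj. eauto.
      - intros j l pj qj rj Hj K. rewrite <- As by exact Hj. eauto. }
    assert (BV : forall i p q r, blk s i p q r -> pr p (pr q r) ∈ V).
    { intros i p q r H. exact (proj2 (maps_rel _ _ _ _ _ Ms H)). }
    exists s. split; [|split; [|split; [|split]]].
    + split; [|split; [|split]].
      * intros i Hi. pose proof (app_codomain _ _ _ _ Ms Hi) as Vi.
        pose proof Vi as Vi'. apply HV in Vi'.
        destruct Vi' as [_ [p [q [r [E _]]]]]. exists p, q, r.
        apply Bs. auto.
      * intros i x x'. apply (maps_unique _ _ _ _ _ _ Ms).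
      * intros i p q r H. apply BV, TV in H. tauto.
      * intros i j p q r p' q' r' L Hi Hj.
        apply (proj1 (proj2 (proj2 (St _ _ _ _ Hj))) i p q r (proj2 L)).
        apply Bs, Hi.
    + intros i p q r H. pose proof (BV _ _ _ _ H) as K. apply TV in K.
      apply Bs in H. tauto.
    + intros p q r H. apply (proj1 (St _ _ _ _ H)). reflexivity.
    + intros i p q r L H. apply (proj1 (proj2 (St _ _ _ _ H))).
      intros ->. exact (lt_irrefl _ L).
    + intros j i l p q r p' q' r' L El Hj Hi.
      apply (proj2 (proj2 (proj2 (St _ _ _ _ Hi))) j l p q r); trivial.
      * exact (proj2 L).
      * apply Bs, Hj.
Qed.

End Blocks.

#[export] Hint Resolve def_blk def_blockseq def_listed def_init : dfn.

(** * The set coded by a real *)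

Section Columns.

Context {M : ZF_model}.
Implicit Types A B F X b e i j k l m n p q r s t x y z : M.

Lemma infinite_sequence (F : M) : dependent_choice M -> ~ finite (elts F) ->
  exists A, maps A omega (elts F) /\
    forall i j, lt j i -> app A j <> app A i.
Proof.
  intros DC HF.
  destruct (dependent_choice_history F
    (fun i s v => forall j, j ∈ i -> app s j <> v) DC) as [A [MA HA]].
  - dfn.
  - intros i s Hi Ms. exact (infinite_avoid i (elts F) s Hi HF Ms).
  - exists A. split; [exact MA|]. intros i j [Hi Hj].
    destruct (HA i Hi) as [s [_ [E K]]]. rewrite <- E by exact Hj. auto.
Qed.

(** By injectivity each index below [b] has at most one preimage, so the second components of these
    preimages have a bound [c]; the pair of [i] and [c] itself is then sent to [b] or beyond. *)
Lemma fiber_unbounded e i b : bijection e (prodc omega omega) omega ->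
  omega i -> omega b -> exists j l, le b j /\ rel e (pr i l) j.
Proof.
  intros [Me [inj _]] Hi Hb.
  destruct (uniform_bound (fun j c => omega c /\
    forall l, rel e (pr i l) j -> l ∈ c) b) as [c [Hc K]]; trivial.
  - dfn.
  - intros j c c' [Hc H] L. split; [exact (le_omega_r _ _ L)|].
    intros l Hl. exact (proj2 (lt_le_trans _ c c' (conj Hc (H l Hl)) L)).
  - intros j _. destruct (classic (exists l, rel e (pr i l) j)) as [[l Hl]|N].
    + assert (Ol : omega l)
        by (apply (maps_rel _ _ _ _ _ Me), proj1, prodc_pr in Hl; tauto).
      exists (succ l). repeat split; try apply omega_succ, Ol. intros l' Hl'.
      specialize (inj _ _ _ Hl Hl'). apply pr_inj in inj.
      destruct inj as [_ <-]. apply lt_succ, Ol.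
    + exists emp. repeat split; try apply omega_emp. intros l Hl.
      destruct N. exists l. exact Hl.
  - assert (Pc : prodc omega omega (pr i c)) by (apply prodc_pr; auto).
    destruct (maps_total _ _ _ _ Me Pc) as [j [Hj El]].
    exists j, c. split; [|exact El].
    destruct (lt_or_le j b Hj Hb) as [L|L]; trivial.
    destruct (mem_irrefl c). exact (proj2 (K j (proj2 L)) c El).
Qed.

Variables A e : M.

Definition col_inf p k : Prop :=
  forall b, omega b -> exists m, le b m /\ pr k m ∈ app A p.

Definition col p q k : Prop :=
  le q k /\ col_inf p k /\ forall k', le q k' -> col_inf p k' -> le k k'.

Definition row p k r m : Prop :=
  le r m /\ pr k m ∈ app A p /\
  forall m', le r m' -> pr k m' ∈ app A p -> le m m'.

(* [(k, m)] is the point of [A p] in its first infinite column of index at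
   least [q], at the first height at least [r]. *)
Definition point p q r k m : Prop := col p q k /\ row p k r m.

Lemma def_col_inf : def2 col_inf.
Proof. unfold col_inf. dfn. Qed.

Hint Resolve def_col_inf : dfn.

Lemma def_col : def3 col.
Proof. unfold col. dfn. Qed.

Lemma def_row : def4 row.
Proof. unfold row. dfn. Qed.

Hint Resolve def_col def_row : dfn.

Lemma def_point : def5 point.
Proof. unfold point. dfn. Qed.

Hint Resolve def_point : dfn.

Lemma col_unique p q k k' : col p q k -> col p q k' -> k = k'.
Proof. intros [H1 [H2 H3]] [K1 [K2 K3]]. apply le_antisym; auto. Qed.

Lemma row_mono p k r r' m m' : le r r' -> row p k r m -> row p k r' m' ->
  le m m'.
Proof.
  intros L [H1 [H2 H3]] [K1 [K2 K3]]. apply H3; trivial.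
  exact (le_trans _ _ _ L K1).
Qed.

Lemma point_unique p q r k m k' m' :
  point p q r k m -> point p q r k' m' -> k = k' /\ m = m'.
Proof.
  intros [H1 H2] [K1 K2]. pose proof (col_unique _ _ _ _ H1 K1). subst k'.
  split; trivial.
  assert (L : le r r) by exact (le_refl r (le_omega _ _ (proj1 H2))).
  apply le_antisym; eapply row_mono; eauto.
Qed.

Lemma col_exists p q : wide (elts (app A p)) -> omega q -> exists k, col p q k.
Proof.
  intros W Hq. destruct (omega_least (fun k => le q k /\ col_inf p k))
    as [k [Hk [[L I] N]]].
  - dfn.
  - destruct (W q Hq) as [k [L I]]. exists k.
    split; [exact (le_omega_r _ _ L)|]. split; [exact L|exact I].
  - exists k. split; [exact L|split; [exact I|]]. intros k' L' I'.
    apply N; auto. exact (le_omega_r _ _ L').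
Qed.

Lemma row_exists p k r : col_inf p k -> omega r -> exists m, row p k r m.
Proof.
  intros I Hr. destruct (omega_least (fun m => le r m /\ pr k m ∈ app A p))
    as [m [Hm [[L K] N]]].
  - dfn.
  - destruct (I r Hr) as [m [L K]]. exists m.
    split; [exact (le_omega_r _ _ L)|]. split; [exact L|exact K].
  - exists m. split; [exact L|split; [exact K|]]. intros m' L' K'.
    apply N; auto. exact (le_omega_r _ _ L').
Qed.

(* [t] is the point that block [i] adds to the column of an earlier block [j];
   the map sending [i] to the first component [j] of its preimage under the
   bijection [e] takes every value unboundedly often. *)
Definition coded s i t : Prop :=
  exists j l p q r p' q' r' k m, lt j i /\ rel e (pr j l) i /\
    blk s j p q r /\ blk s i p' q' r' /\ point p q r' k m /\ t = pr k m.

Lemma def_coded : def3 coded.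
Proof. unfold coded. dfn. Qed.

Hint Resolve def_coded : dfn.

(* [decode z] is the subset of omega x omega coded by the set [z]. *)
Definition decode z t : Prop :=
  exists s i, blockseq s /\ init s i z /\ coded s i t.

Lemma def_decode : def2 decode.
Proof. unfold decode. dfn. Qed.

Hint Resolve def_decode : dfn.

(** A witness uses [z] only up to the end of one block, so [decode z t] is an open condition on
    [z]. *)
Lemma decode_local z t : decode z t ->
  exists n, omega n /\ forall z', agree z z' n -> decode z' t.
Proof.
  intros [s [i [Hs [[Hi Iz] Ht]]]].
  destruct (proj1 Hs i Hi) as [p [q [r B]]].
  assert (Or : omega r)
    by exact (lt_omega_r _ _ (proj2 (proj1 (proj2 (proj2 Hs)) _ _ _ _ B))).
  (* [init] tests numbers up to and including [r], while [agree] tests the elements of its bound. *)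
  exists (succ r). split; [apply omega_succ, Or|]. intros z' Hz.
  exists s, i. split; [exact Hs|split; [|exact Ht]]. split; [exact Hi|].
  intros p' q' r' B' m Lm.
  destruct (blk_inj _ _ _ _ _ _ _ _ Hs B B') as [_ [_ <-]].
  rewrite <- (Hz m); [apply (Iz _ _ _ B m Lm)|]. apply le_lt_succ, Lm.
Qed.

Variables F B : M.
Hypothesis HF : fin_fin_mad F.
Hypothesis MA : maps A omega (elts F).
Hypothesis RB : real B.
Hypothesis UB : forall b, omega b -> exists k, k ∈ B /\ le b k.

Let wideA p : omega p -> wide (elts (app A p)).
Proof. intros Hp. exact (mad_wide F _ HF (app_codomain _ _ _ _ MA Hp)). Qed.

Lemma point_exists p q r : omega p -> omega q -> omega r ->
  exists k m, point p q r k m.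
Proof.
  intros Hp Hq Hr. destruct (col_exists p q (wideA p Hp) Hq) as [k Hk].
  destruct (row_exists p k r (proj1 (proj2 Hk)) Hr) as [m Hm].
  exists k, m. split; trivial.
Qed.

(** Such a pair selects a column in which the later entries [r] can always be chosen from [B] so
    that their points fall into [y]. *)
Definition good y p q : Prop :=
  p ∈ B /\ q ∈ B /\ lt p q /\ forall b, omega b ->
    exists r k m, le b r /\ r ∈ B /\ point p q r k m /\ pr k m ∈ y.

Lemma def_good : def3 good.
Proof. unfold good. dfn. Qed.

(** The points coded by the pairs of neighbours in [B] form a wide set [h], and [mad_meets] gives
    [y]. If no good pair had [p] at least [N], then far enough to the right every column of the
    intersection of [y] and [h] would be a finite union of bounded pieces, contrary to wideness. *)
Lemma exists_good : exists y, y ∈ F /\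
  forall n, omega n -> exists p q, le n p /\ good y p q.
Proof.
  (* Fixing one [q] for each [p] leaves one column per [p], so only finitely many columns come from
     [p] below a given bound. *)
  set (next := fun p q => p ∈ B /\ q ∈ B /\ lt p q /\
    forall q', q' ∈ B -> lt p q' -> le q q').
  assert (Dn : def2 next) by (unfold next; dfn).
  assert (next_exists : forall p, p ∈ B -> exists q, next p q).
  { intros p Hp. destruct (omega_least (fun q => q ∈ B /\ lt p q))
      as [q [_ [[Hq L] N]]]; [dfn| |].
    - destruct (UB (succ p) (omega_succ p (RB p Hp))) as [q [Hq L]].
      exists q. split; [apply RB, Hq|]. split; [exact Hq|].
      exact (lt_le_trans _ _ _ (lt_succ p (RB p Hp)) L).
    - exists q. split; [exact Hp|split; [exact Hq|split; [exact L|]]].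
      intros q' Hq' L'. apply N; auto. }
  assert (next_unique : forall p q q', next p q -> next p q' -> q = q').
  { intros p q q' [_ [H1 [H2 H3]]] [_ [K1 [K2 K3]]]. apply le_antisym; auto. }
  destruct (product_set (@om M) om) as [c Hc].
  destruct (comprehension (fun t => exists p q r k m,
    next p q /\ r ∈ B /\ point p q r k m /\ t = pr k m) c) as [h Hh]; [dfn|].
  assert (Ph : forall k m, pr k m ∈ h <->
    exists p q r, next p q /\ r ∈ B /\ point p q r k m).
  { intros k m. rewrite Hh, Hc. split.
    - intros [_ [p [q [r [k' [m' [H1 [H2 [H3 E]]]]]]]]].
      apply pr_inj in E. destruct E as [<- <-]. exists p, q, r. auto.
    - intros [p [q [r [H1 [H2 H3]]]]]. split.
      + exists k, m. rewrite !in_om. destruct H3 as [[L _] [L' _]].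
        eauto using le_omega_r.
      + exists p, q, r, k, m. auto. }
  destruct (mad_meets F h HF) as [y [Fy Wy]].
  { intros t Ht. apply Hh in Ht. destruct Ht as [Ht _]. apply Hc in Ht.
    destruct Ht as [x [x' [Hx [Hx' ->]]]]. rewrite in_om in *.
    apply prodc_pr. auto. }
  { intros n Hn. destruct (UB n Hn) as [p [Hp Lp]].
    destruct (next_exists p Hp) as [q Hq].
    assert (lt p q) as Lpq by apply Hq.
    destruct (col_exists p q (wideA p (RB p Hp)) (lt_omega_r _ _ Lpq))
      as [k Hk].
    exists k. split.
    - apply (le_trans _ p); trivial. apply lt_le, (lt_le_trans _ q); trivial.
      apply Hk.
    - intros b Hb. destruct (UB b Hb) as [r [Hr Lr]].
      destruct (row_exists p k r (proj1 (proj2 Hk)) (RB r Hr)) as [m Hm].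
      exists m. split; [exact (le_trans _ _ _ Lr (proj1 Hm))|].
      apply Ph. exists p, q, r. split; [exact Hq|split; [exact Hr|]].
      split; trivial. }
  exists y. split; [exact Fy|]. intros N HN. apply NNPP. intros NG.
  (* [N'] is to the right of all columns that come from [p] below [N]. *)
  destruct (uniform_bound (fun p b => omega b /\
    forall q k, next p q -> col p q k -> lt k b) N) as [N' [HN' KN]]; trivial.
  { dfn. }
  { intros p b b' [Hb H] L. split; [exact (le_omega_r _ _ L)|].
    eauto using lt_le_trans. }
  { intros p _. destruct (classic (exists q k, next p q /\ col p q k))
      as [[q [k [Hq Hk]]]|Z].
    - pose proof (le_omega_r _ _ (proj1 Hk)) as Ok. exists (succ k).
      split; [apply omega_succ, Ok|]. split; [apply omega_succ, Ok|].
      intros q' k' Hq' Hk'. rewrite <- (next_unique _ _ _ Hq Hq') in Hk'.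
      rewrite <- (col_unique _ _ _ _ Hk Hk'). apply lt_succ, Ok.
    - exists emp. split; [apply omega_emp|]. split; [apply omega_emp|].
      intros q k Hq Hk. destruct Z. exists q, k. auto. }
  destruct (Wy N' HN') as [k [Lk Wk]].
  (* Only [p] below [k] can select column [k], since [p] is below [q] and [q] is at most [k]; bounds
     for each of them yield one for the whole column. *)
  destruct (uniform_bound (fun p b => omega b /\
    forall q r m, next p q -> r ∈ B -> point p q r k m -> pr k m ∈ y -> lt m b)
    k) as [b [Hb Kb]].
  { dfn. }
  { exact (le_omega_r _ _ Lk). }
  { intros p b b' [Hb H] L. split; [exact (le_omega_r _ _ L)|].
    eauto using lt_le_trans. }
  { intros p Hp.
    destruct (classic (exists q, next p q /\ col p q k)) as [[q [Hq Hk]]|Z].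
    - assert (LN : le N p).
      { pose proof (RB p (proj1 Hq)) as Op.
        destruct (lt_or_le p N Op HN) as [L|L]; trivial.
        destruct (lt_not_le k N'); trivial.
        exact (proj2 (KN p (proj2 L)) q k Hq Hk). }
      assert (NB : exists b, omega b /\ forall r m,
        le b r -> r ∈ B -> point p q r k m -> pr k m ∉ y).
      { apply NNPP. intros NB. apply NG. exists p, q. split; [exact LN|].
        pose proof Hq as [Bp [Bq [Lpq _]]].
        split; [exact Bp|split; [exact Bq|split; [exact Lpq|]]].
        intros b Hb. apply NNPP. intros Z. apply NB. exists b.
        split; [exact Hb|]. intros r m L Hr Pm Ym. apply Z.
        exists r, k, m. auto. }
      destruct NB as [b [Hb Kb]].
      destruct (row_exists p k b (proj1 (proj2 Hk)) Hb) as [mb Hmb].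
      pose proof (le_omega_r _ _ (proj1 Hmb)) as Omb.
      exists (succ mb). split; [apply omega_succ, Omb|].
      split; [apply omega_succ, Omb|]. intros q' r m Hq' Hr Pm Ym.
      rewrite <- (next_unique _ _ _ Hq Hq') in Pm.
      (* For [r] below [b] the height stays at most [mb] by monotonicity; from [b] on the point is
         outside [y]. *)
      destruct (lt_or_le r b (RB r Hr) Hb) as [L|L].
      + apply le_lt_succ.
        exact (row_mono p k r b m mb (lt_le _ _ L) (proj2 Pm) Hmb).
      + destruct (Kb r m L Hr Pm Ym).
    - exists emp. split; [apply omega_emp|]. split; [apply omega_emp|].
      intros q r m Hq Hr Pm _. destruct Z. exists q.
      split; [exact Hq|apply Pm]. }
  destruct (Wk b Hb) as [m [Lm [Ym Hm]]]. apply Ph in Hm.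
  destruct Hm as [p [q [r [Hq [Hr Pm]]]]]. pose proof Hq as [_ [_ [Lpq _]]].
  apply (lt_not_le m b); [|exact Lm].
  apply (proj2 (Kb p (proj2 (lt_le_trans p q k Lpq (proj1 (proj1 Pm))))) q r m);
    trivial.
Qed.

(** [decode] admits any block sequence as witness; by uniqueness of blocks it agrees with [s] on the
    blocks it uses. *)
Lemma decode_range s z t : blockseq s -> range s z -> real z -> decode z t ->
  exists i, omega i /\ coded s i t.
Proof.
  intros Hs Rz Oz [s' [i [Hs' [Ii Ht]]]]. exists i. split; [apply Ii|].
  destruct Ht as [j [l [p [q [r [p' [q' [r' [k [m [L [El [Bj [Bi T]]]]]]]]]]]]]].
  pose proof (blocks_unique s s' z i Hs Hs' Rz Oz Ii) as U.
  exists j, l, p, q, r, p', q', r', k, m.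
  split; [exact L|split; [exact El|split; [|split; [|exact T]]]].
  - apply (U j (lt_omega _ _ L) (lt_le _ _ L)), Bj.
  - apply (U i (lt_omega_r _ _ L) (le_refl _ (lt_omega_r _ _ L))), Bi.
Qed.

Lemma range_exists s : blockseq s ->
  (forall i p q r, blk s i p q r -> omega i /\ p ∈ B /\ q ∈ B /\ r ∈ B) ->
  exists z, range s z /\ real z /\ infsubs (elts B) z.
Proof.
  intros Hs HB.
  destruct (comprehension (fun m => exists i, omega i /\ listed s i m) om)
    as [z Hz]; [dfn|].
  assert (ZB : forall m, (exists i, omega i /\ listed s i m) -> m ∈ B).
  { intros m [_ [_ [j [p [q [r [_ [Bj Hm]]]]]]]]. apply HB in Bj.
    destruct Hm as [-> |[-> | ->]]; tauto. }
  assert (Rz : range s z).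
  { intros m. rewrite Hz, in_om. split; [tauto|]. intros H. split; [|exact H].
    apply RB, ZB, H. }
  assert (Oz : real z) by (intros m Hm; apply RB, ZB, Rz, Hm).
  exists z. split; [exact Rz|split; [exact Oz|split]].
  - intros m Hm. apply ZB, Rz, Hm.
  - apply infinite_omega_iff; [exact Oz|]. intros b Hb.
    destruct (proj1 Hs b Hb) as [p [q [r Bb]]]. exists p. split.
    + apply Rz. exists b. split; [exact Hb|]. exists b, p, q, r.
      auto using le_refl.
    + exact (block_growth s Hs b Hb p q r Bb).
Qed.

Hypothesis He : bijection e (prodc omega omega) omega.
Hypothesis DC : dependent_choice M.

Lemma some_decoded : exists z y, infsubs (elts B) z /\ y ∈ F /\
  forall t, decode z t -> t ∈ y.
Proof.
  destruct exists_good as [y [Fy Gy]].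
  assert (Dg : def2 (good y)).
  { pose proof def_good. unfold def2. dfn. }
  (* All blocks take good pairs, and [R] confines every coded point to [y]. *)
  destruct (block_selection e B (good y) (good y)
    (fun p q r => exists k m, point p q r k m /\ pr k m ∈ y))
    as [s [Hs [SB [_ [_ SR]]]]]; trivial.
  - dfn.
  - unfold good. tauto.
  - intros p q H b Hb. assert (G : good y p q) by tauto.
    destruct G as [_ [_ [_ G]]]. destruct (G b Hb) as [r [k [m K]]].
    exists r. split; [tauto|split; [tauto|]]. exists k, m. tauto.
  - destruct (Gy emp omega_emp) as [p [q [_ G]]]. exists p, q. exact G.
  - destruct (range_exists s Hs SB) as [z [Rz [Oz Iz]]]. exists z, y.
    split; [exact Iz|split; [exact Fy|]]. intros t Ht.
    destruct (decode_range s z t Hs Rz Oz Ht) as [i [_ Ct]].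
    destruct Ct as [j [l [p [q [r [p' [q' [r' [k [m [L [El [Bj [Bi [Pm ->]]]]]]]]]]]]]]].
    destruct (SR _ _ _ _ _ _ _ _ _ L El Bj Bi) as [k' [m' [Pm' Ym]]].
    destruct (point_unique _ _ _ _ _ _ _ Pm Pm') as [-> ->]. exact Ym.
Qed.

Hypothesis inj : forall i j, lt j i -> app A j <> app A i.

(* The first column of [s] meets the good element [y] in a bounded set while
   all others are inside [y], so only [y] could contain the set coded by the
   range of [s], but it does not. *)
Lemma some_not_decoded : exists z, infsubs (elts B) z /\
  ~ exists y, y ∈ F /\ forall t, decode z t -> t ∈ y.
Proof.
  destruct exists_good as [y [Fy Gy]].
  (* [A] takes different values at two elements of [B], and at most one of these values is [y]. *)
  assert (Ex : exists p, p ∈ B /\ app A p <> y).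
  { destruct (UB emp omega_emp) as [p1 [H1 _]].
    destruct (UB (succ p1) (omega_succ _ (RB _ H1))) as [p2 [H2 L]].
    destruct (classic (app A p1 = y)) as [E|E]; [|exists p1; auto].
    exists p2. split; [exact H2|]. intros E'.
    apply (inj p2 p1); [|congruence].
    exact (lt_le_trans _ _ _ (lt_succ _ (RB _ H1)) L). }
  destruct Ex as [p0 [Bp0 Np0]]. pose proof (RB _ Bp0) as Op0.
  assert (Bad : exists n, omega n /\ forall k, le n k -> exists b, omega b /\
    forall m, le b m -> ~ (pr k m ∈ y /\ pr k m ∈ app A p0)).
  { apply NNPP. intros N. apply Np0. symmetry.
    apply (mad_disjoint F); trivial; [exact (app_codomain _ _ _ _ MA Op0)|].
    intros n Hn. apply NNPP. intros K. apply N. exists n. split; trivial.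
    intros k L. apply NNPP. intros K'. apply K. exists k. split; trivial.
    intros b Hb. apply NNPP. intros K''. apply K'. exists b. split; trivial.
    intros m Lm Ym. apply K''. exists m. auto. }
  destruct Bad as [n [Hn Bad]].
  (* [q0] will lie beyond [n], where columns of [app A p0] meet [y] boundedly, and beyond [p0], as a
     block must increase. *)
  destruct (upper_bound2 n (succ p0) Hn (omega_succ _ Op0)) as [c [Lc Lc']].
  destruct (UB c (le_omega_r _ _ Lc)) as [q0 [Bq0 Lq0]].
  pose proof (RB _ Bq0) as Oq0.
  assert (L0 : lt p0 q0).
  { apply (lt_le_trans _ (succ p0)); [apply lt_succ, Op0|].
    exact (le_trans _ _ _ Lc' Lq0). }
  assert (Bad0 : exists b, omega b /\
    forall r k m, le b r -> point p0 q0 r k m -> pr k m ∉ y).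
  { destruct (col_exists p0 q0 (wideA p0 Op0) Oq0) as [k0 Hk0].
    destruct (Bad k0) as [b [Hb K]].
    - apply (le_trans _ c); trivial. apply (le_trans _ q0); trivial. apply Hk0.
    - exists b. split; trivial. intros r k m L [Ck Rm] Ym.
      rewrite (col_unique _ _ _ _ Ck Hk0) in *. apply (K m).
      + exact (le_trans _ _ _ L (proj1 Rm)).
      + split; trivial. exact (proj1 (proj2 Rm)). }
  destruct Bad0 as [b0 [Hb0 Bad0]].
  (* Later blocks use good pairs, so the exceptional pair does not recur there and the case
     distinction in [R] singles out the first block. *)
  assert (Ngood : ~ good y p0 q0).
  { intros [_ [_ [_ G]]]. destruct (G b0 Hb0) as [r [k [m [L [_ [P Y]]]]]].
    exact (Bad0 r k m L P Y). }
  assert (Dg : def2 (good y)).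
  { pose proof def_good. unfold def2. dfn. }
  destruct (block_selection e B (fun p q => p = p0 /\ q = q0) (good y)
    (fun p q r => (p = p0 /\ q = q0 -> forall k m, point p q r k m -> pr k m ∉ y) /\
       (~ (p = p0 /\ q = q0) -> exists k m, point p q r k m /\ pr k m ∈ y)))
    as [s [Hs [SB [S0 [S1 SR]]]]]; trivial.
  - dfn.
  - dfn.
  - intros p q [[-> ->]|G]; [auto|]. unfold good in G. tauto.
  - intros p q H b Hb. destruct (classic (p = p0 /\ q = q0)) as [[-> ->]|N].
    + destruct (upper_bound2 b b0 Hb Hb0) as [d [L L']].
      destruct (UB d (le_omega_r _ _ L)) as [r [Br Lr]]. exists r.
      split; [exact (le_trans _ _ _ L Lr)|split; [exact Br|]].
      split; [|tauto]. intros _ k m. apply Bad0. exact (le_trans _ _ _ L' Lr).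
    + destruct H as [H|[_ [_ [_ G]]]]; [tauto|].
      destruct (G b Hb) as [r [k [m K]]]. exists r.
      split; [tauto|split; [tauto|]]. split; [tauto|]. intros _.
      exists k, m. tauto.
  - exists p0, q0. auto.
  - destruct (range_exists s Hs SB) as [z [Rz [Oz Iz]]]. exists z.
    split; [exact Iz|]. intros [y' [Fy' Dy']].
    assert (Cy : forall i t, omega i -> coded s i t -> t ∈ y').
    { intros i t Hi Ct. apply Dy'. exists s, i.
      split; [exact Hs|split; [|exact Ct]]. apply range_init; trivial. }
    pose proof Hs as [tot [_ [inc _]]].
    (* The columns of the later blocks have infinitely many coded points, all chosen in [y] and all
       contained in [y']; so the two members are not almost disjoint. *)
    assert (E : y = y').
    { apply (mad_disjoint F); trivial. intros a Ha.
      pose proof (omega_succ a Ha) as Ha'.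
      (* The index [succ a] avoids the exceptional first block and puts the column beyond [a]. *)
      destruct (tot (succ a) Ha') as [p [q [r Bp]]].
      assert (Gp : good y p q).
      { apply (S1 (succ a) p q r); trivial. apply le_lt_succ, emp_le, Ha. }
      assert (Npq : ~ (p = p0 /\ q = q0)) by (intros [-> ->]; auto).
      destruct (inc _ _ _ _ Bp) as [Lpq _].
      destruct (col_exists p q (wideA p (lt_omega _ _ Lpq)) (lt_omega_r _ _ Lpq))
        as [k Hk].
      exists k. split.
      - apply (le_trans _ (succ a)); [apply lt_le, lt_succ, Ha|].
        apply (le_trans _ p); [exact (block_growth s Hs _ Ha' _ _ _ Bp)|].
        apply lt_le, (lt_le_trans _ q); trivial. apply Hk.
      - intros b Hb.
        (* [d] secures both the height [b] and an index [i] later than block [succ a]. *)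
        destruct (upper_bound2 b (succ (succ a)) Hb (omega_succ _ Ha'))
          as [d [Ld Ld']].
        destruct (fiber_unbounded e (succ a) d He Ha' (le_omega_r _ _ Ld))
          as [i [l [Li El]]].
        assert (Lai : lt (succ a) i).
        { apply (lt_le_trans _ (succ (succ a))); [apply lt_succ, Ha'|].
          exact (le_trans _ _ _ Ld' Li). }
        destruct (tot i (le_omega_r _ _ Li)) as [p' [q' [r' Bi]]].
        destruct (proj2 (SR _ _ _ _ _ _ _ _ _ Lai El Bp Bi) Npq)
          as [k' [m [Pm Ym]]].
        pose proof (col_unique _ _ _ _ Hk (proj1 Pm)). subst k'.
        exists m. split; [|split; [exact Ym|]].
        + destruct (inc _ _ _ _ Bi) as [L1 L2].
          apply (le_trans _ d); trivial. apply (le_trans _ i); trivial.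
          apply (le_trans _ p').
          * apply (block_growth s Hs i (le_omega_r _ _ Li) _ _ _ Bi).
          * apply (le_trans _ r'); [|exact (proj1 (proj2 Pm))].
            apply lt_le, (lt_trans _ q'); trivial.
        + apply (Cy i); [exact (le_omega_r _ _ Li)|].
          exists (succ a), l, p, q, r, p', q', r', k, m. auto 7. }
    subst y'.
    (* A point that some later block adds to the exceptional column is outside [y] by [R], yet coded
       and hence inside. *)
    destruct (fiber_unbounded e emp (succ emp) He omega_emp
      (omega_succ _ omega_emp)) as [i [l [Li El]]].
    pose proof (lt_le_trans _ _ _ (lt_succ _ omega_emp) Li) as L.
    destruct (tot emp omega_emp) as [p [q [r B0]]].
    destruct (S0 _ _ _ B0) as [-> ->].
    destruct (tot i (le_omega_r _ _ Li)) as [p' [q' [r' Bi]]].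
    destruct (inc _ _ _ _ Bi) as [_ L2].
    destruct (point_exists p0 q0 r' Op0 Oq0 (lt_omega_r _ _ L2))
      as [k [m Pm]].
    apply (proj1 (SR _ _ _ _ _ _ _ _ _ L El B0 Bi) (conj eq_refl eq_refl)
      k m Pm).
    apply (Cy i); [exact (le_omega_r _ _ Li)|].
    exists emp, l, p0, q0, r, p', q', r', k, m. auto 7.
Qed.

End Columns.

#[export] Hint Resolve def_col_inf def_col def_row def_point def_coded
  def_decode : dfn.

Lemma mad_not_ramsey {M : ZF_model} (A e F X : M) :
  dependent_choice M -> fin_fin_mad F ->
  bijection e (prodc omega omega) omega ->
  maps A omega (elts F) -> (forall i j, lt j i -> app A j <> app A i) ->
  (forall z, z ∈ X <-> infsubs omega z /\
     exists y, y ∈ F /\ forall t, decode A e z t -> t ∈ y) ->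
  ~ ramsey X.
Proof.
  intros DC HF He MA inj HX [B [[RB IB] H]].
  pose proof (proj1 (infinite_omega_iff B RB) IB) as UB.
  destruct H as [H|H].
  - destruct (some_not_decoded A e F B HF MA RB UB He DC inj) as [z [Iz N]].
    apply N. apply H, HX in Iz. apply Iz.
  - destruct (some_decoded A e F B HF MA RB UB He DC) as [z [y [Iz Y]]].
    apply (H z Iz), HX. split; [|exists y; exact Y].
    split; [|apply Iz]. intros k Hk. apply RB, Iz, Hk.
Qed.

(** * Borel and projective sets *)

Section Borel.

Context {M : ZF_model}.
Implicit Types F T U X Y Z b e f h i j k m n p s t u w x y z : M.

Lemma def_real : def1 (@real M).
Proof. unfold real. dfn. Qed.

Lemma def_set_of_reals : def1 (@set_of_reals M).
Proof. pose proof def_real. unfold set_of_reals. dfn. Qed.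

Lemma def_agree : def3 (@agree M).
Proof. unfold agree. dfn. Qed.

Hint Resolve def_real def_set_of_reals def_agree : dfn.

Lemma def_open : def1 (@open_set M).
Proof. unfold open_set. dfn. Qed.

Lemma def_compl : def2 (@compl M).
Proof. unfold compl. dfn. Qed.

Hint Resolve def_open def_compl : dfn.

Lemma def_sigma : def1 (@sigma_algebra M).
Proof. unfold sigma_algebra. dfn. Qed.

Hint Resolve def_sigma : dfn.

Lemma def_borel : def1 (@borel M).
Proof. unfold borel. dfn. Qed.

Lemma def_continuous : def1 (@continuous M).
Proof. unfold continuous. dfn. Qed.

Hint Resolve def_borel def_continuous : dfn.

Lemma reals_set : exists a : M, forall x, x ∈ a <-> real x.
Proof.
  destruct (power_set M om) as [a Ha]. exists a. intros x. rewrite Ha.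
  unfold real. split; intros H k Hk; apply in_om, H, Hk.
Qed.

Lemma real_comprehension (P : M -> Prop) : def1 P ->
  exists X, forall x, x ∈ X <-> real x /\ P x.
Proof.
  intros DP. destruct reals_set as [a Ha].
  destruct (comprehension P a DP) as [X HX]. exists X. intros x.
  rewrite HX, Ha. tauto.
Qed.

Lemma agree_le x y m n : agree x y n -> le m n -> agree x y m.
Proof.
  intros H L k Hk. apply H. destruct L as [Hn [L| ->]]; trivial.
  exact (omega_trans n Hn m k L Hk).
Qed.

Definition is_borel (P : M -> Prop) : Prop :=
  exists X, borel X /\ forall x, x ∈ X <-> real x /\ P x.

Lemma is_borel_iff (P Q : M -> Prop) :
  (forall x, real x -> (P x <-> Q x)) -> is_borel P -> is_borel Q.
Proof.
  intros H [X [BX HX]]. exists X. split; [exact BX|]. intros x. rewrite HX.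
  split; intros [Rx K]; split; trivial; apply (H x Rx), K.
Qed.

Lemma is_borel_borel X : borel X -> is_borel (elts X).
Proof.
  intros BX. exists X. split; [exact BX|]. intros x. unfold elts.
  split; [|tauto]. intros Hx. split; trivial. exact (proj1 BX x Hx).
Qed.

Lemma is_borel_open (P : M -> Prop) : def1 P ->
  (forall x, real x -> P x -> exists n, omega n /\
     forall y, real y -> agree x y n -> P y) ->
  is_borel P.
Proof.
  intros DP HP. destruct (real_comprehension P DP) as [X HX].
  assert (SX : set_of_reals X) by (intros x Hx; apply HX, Hx).
  exists X. split; [|exact HX]. split; [exact SX|]. intros F _ HF. apply HF.
  split; [exact SX|]. intros x Hx. apply HX in Hx.
  destruct (HP x) as [n [Hn K]]; try tauto. exists n. split; [exact Hn|].
  intros y Ry Hy. apply HX. auto.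
Qed.

Lemma is_borel_not (P : M -> Prop) : is_borel P -> is_borel (fun x => ~ P x).
Proof.
  intros [X [BX HX]].
  destruct (real_comprehension (fun x => x ∉ X)) as [Y HY]; [dfn|].
  exists Y. split; [split|].
  - intros x Hx. apply HY, Hx.
  - intros F SF HF. apply (proj1 (proj2 SF) X Y); [|exact HY].
    apply BX; trivial.
  - intros x. rewrite HY, HX. tauto.
Qed.

(** [G n] determines its set of reals by extensionality, so the sequence of these sets exists inside
    any given sigma-algebra without a choice of one set per index. *)
Lemma is_borel_union (G : M -> M -> Prop) : def2 G ->
  (forall n, omega n -> is_borel (G n)) ->
  is_borel (fun x => exists n, omega n /\ G n x).
Proof.
  intros DG HG.
  destruct (real_comprehension (fun x => exists n, omega n /\ G n x))
    as [Y HY]; [dfn|].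
  exists Y. split; [split|exact HY].
  - intros x Hx. apply HY, Hx.
  - intros F SF HF.
    destruct (function_set om F (fun n X => forall x, x ∈ X <-> real x /\ G n x))
      as [f [Mf Rf]].
    + dfn.
    + intros n Hn. apply in_om in Hn. destruct (HG n Hn) as [X [BX HX]].
      exists X. split; [apply BX; trivial|exact HX].
    + intros n X X' _ _ _ H H'. apply extensionality. intros x.
      rewrite H, H'. tauto.
    + apply (proj2 (proj2 SF) f Y).
      * split; [intros p Hp|intros n Hn].
        -- apply (proj1 Mf) in Hp. apply prodc_elim in Hp. apply prodc_elim.
           destruct Hp as [n [X [Hn K]]]. exists n, X. split; [|exact K].
           apply in_om, Hn.
        -- apply (proj2 Mf). apply in_om, Hn.
      * intros x. rewrite HY. split.
        -- intros [Rx [n [Hn K]]]. pose proof Hn as Hn'. apply in_om in Hn'.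
           destruct (maps_total _ _ _ n Mf Hn') as [X [_ HX]].
           exists n, X. split; [exact HX|]. apply Rf in HX. apply HX. auto.
        -- intros [n [X [HX Hx]]]. apply Rf in HX.
           destruct HX as [Hn [_ HX]]. apply HX in Hx. apply in_om in Hn.
           split; [apply Hx|]. exists n. tauto.
Qed.

Lemma is_borel_or (P Q : M -> Prop) :
  is_borel P -> is_borel Q -> is_borel (fun x => P x \/ Q x).
Proof.
  intros [X [BX HX]] [Y [BY HY]].
  (* A countable union with one set at index 0 and the other at all remaining indices. *)
  apply (is_borel_iff (fun x => exists n, omega n /\
    ((n = emp /\ x ∈ X) \/ (n <> emp /\ x ∈ Y)))).
  - intros x Rx. split.
    + intros [n [_ [[_ H]|[_ H]]]]; [apply HX in H|apply HY in H]; tauto.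
    + intros [H|H].
      * exists emp. split; [apply omega_emp|]. left. rewrite HX. auto.
      * exists (succ emp). split; [apply omega_succ, omega_emp|]. right.
        rewrite HY. split; [|auto]. intros E. exact (emp_neq_one (eq_sym E)).
  - apply is_borel_union; [dfn|]. intros n _. destruct (classic (n = emp)).
    + apply (is_borel_iff (elts X)); [unfold elts; tauto|].
      apply is_borel_borel, BX.
    + apply (is_borel_iff (elts Y)); [unfold elts; tauto|].
      apply is_borel_borel, BY.
Qed.

Lemma is_borel_and (P Q : M -> Prop) :
  is_borel P -> is_borel Q -> is_borel (fun x => P x /\ Q x).
Proof.
  intros HP HQ. apply (is_borel_iff (fun x => ~ (~ P x \/ ~ Q x))).
  - intros x _. tauto.
  - apply is_borel_not, is_borel_or; apply is_borel_not; assumption.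
Qed.

(** Unboundedness is a countable intersection of open conditions. *)
Lemma is_borel_infinite : is_borel (fun x : M => ~ finite (elts x)).
Proof.
  apply (is_borel_iff (fun x => ~ exists b, omega b /\
    ~ exists k, k ∈ x /\ le b k)).
  - intros x Rx. rewrite infinite_omega_iff by exact Rx. split.
    + intros H b Hb. apply NNPP. intros K. apply H. exists b. auto.
    + intros H [b [Hb K]]. auto.
  - apply is_borel_not, is_borel_union; [dfn|]. intros b Hb.
    apply is_borel_not, is_borel_open; [dfn|].
    intros x Rx [k [Hk L]]. exists (succ k).
    split; [apply omega_succ, Rx, Hk|]. intros y _ H. exists k.
    split; [|exact L]. apply H; trivial. apply in_adjoin. auto.
Qed.

(** Rocq functions with definable graph compose directly; the next two lemmas translate from and to
    function sets of the model. *)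
Definition continuous_fun (g : M -> M) : Prop :=
  dfun1 g /\ (forall x, real x -> real (g x)) /\
  forall x n, real x -> omega n -> exists m, omega m /\
    forall y, real y -> agree x y m -> agree (g x) (g y) n.

Lemma continuous_fun_app f : continuous f -> continuous_fun (app f).
Proof.
  intros [Mf Cf]. split; [unfold dfun1; dfn|split].
  - intros x Rx. exact (app_codomain _ _ _ _ Mf Rx).
  - intros x n Rx Hn. destruct (Cf x n Rx Hn) as [m [Hm K]].
    exists m. split; [exact Hm|]. intros y Ry H.
    apply (K y); trivial; apply (maps_app _ _ _ _ Mf); trivial.
Qed.

Lemma continuous_fun_set g : continuous_fun g ->
  exists f, continuous f /\ forall x y, rel f x y <-> real x /\ y = g x.
Proof.
  intros [Dg [Rg Cg]]. destruct reals_set as [a Ha].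
  destruct (function_set a a (fun x y => y = g x)) as [f [Mf Rf]].
  - unfold dfun1 in Dg. dfn.
  - intros x Hx. exists (g x). split; [|reflexivity].
    apply Ha, Rg, Ha, Hx.
  - intros x y y' _ _ _ -> ->. reflexivity.
  - assert (K : forall x y, rel f x y <-> real x /\ y = g x).
    { intros x y. rewrite Rf, !Ha. split; [tauto|]. intros [Rx ->]. auto. }
    exists f. split; [|exact K]. split.
    + split.
      * intros p Hp. apply (proj1 Mf) in Hp. apply prodc_elim in Hp.
        apply prodc_elim. destruct Hp as [x [y [Hx [Hy ->]]]]. exists x, y.
        rewrite <- !Ha. auto.
      * intros x Rx. apply (proj2 Mf), Ha, Rx.
    + intros x n Rx Hn. destruct (Cg x n Rx Hn) as [m [Hm L]].
      exists m. split; [exact Hm|]. intros y x' y' Ry H Hx Hy.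
      apply K in Hx, Hy. destruct Hx as [_ ->], Hy as [_ ->]. auto.
Qed.

Lemma continuous_fun_comp g g' : continuous_fun g -> continuous_fun g' ->
  continuous_fun (fun x => g (g' x)).
Proof.
  intros [Dg [Rg Cg]] [Dg' [Rg' Cg']]. split; [|split].
  - unfold dfun1. dfn.
  - auto.
  - intros x n Rx Hn. destruct (Cg (g' x) n) as [m [Hm K]]; auto.
    destruct (Cg' x m Rx Hm) as [l [Hl L]]. exists l. auto.
Qed.

Lemma continuous_fun_id : continuous_fun (fun x : M => x).
Proof.
  split; [unfold dfun1; dfn|]. split; [auto|]. intros x n _ Hn. exists n. auto.
Qed.

(** The sets of reals whose preimage belongs to a given sigma-algebra [F] form a sigma-algebra [F'],
    which contains the open sets by continuity. *)
Lemma is_borel_preimage (g : M -> M) (P : M -> Prop) :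
  continuous_fun g -> is_borel P -> is_borel (fun x => P (g x)).
Proof.
  intros [Dg [Rg Cg]] [X [BX HX]].
  assert (pre : forall Z, exists W, forall x, x ∈ W <-> real x /\ g x ∈ Z)
    by (intros Z; apply (real_comprehension (fun x => g x ∈ Z)); dfn).
  assert (pre_unique : forall Z W W', (forall x, x ∈ W <-> real x /\ g x ∈ Z) ->
    (forall x, x ∈ W' <-> real x /\ g x ∈ Z) -> W = W').
  { intros Z W W' H H'. apply extensionality. intros x. rewrite H, H'. tauto. }
  destruct (pre X) as [Y HY]. exists Y. split.
  - split; [intros x Hx; apply HY, Hx|]. intros F SF HF.
    destruct reals_set as [a Ha]. destruct (power_set M a) as [c Hc].
    destruct (comprehension (fun Z => exists W, W ∈ F /\
      forall x, x ∈ W <-> real x /\ g x ∈ Z) c) as [F' HF']; [dfn|].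
    assert (K : forall Z, Z ∈ F' <-> set_of_reals Z /\
      exists W, W ∈ F /\ forall x, x ∈ W <-> real x /\ g x ∈ Z).
    { intros Z. rewrite HF', Hc. unfold set_of_reals.
      assert ((forall t, t ∈ Z -> t ∈ a) <-> (forall t, t ∈ Z -> real t))
        by (split; intros H t Ht; apply Ha, H, Ht).
      tauto. }
    assert (KX : X ∈ F').
    { apply BX.
      - split; [|split].
        + intros Z HZ. apply K, HZ.
        + intros Z Z' HZ C. apply K in HZ. apply K.
          split; [intros x Hx; apply C, Hx|].
          destruct HZ as [_ [W [FW HW]]]. destruct (pre Z') as [W' HW'].
          exists W'. split; [|exact HW'].
          apply (proj1 (proj2 SF) W W' FW). intros x.
          rewrite HW', HW, (C (g x)). pose proof (Rg x). tauto.
        + intros f Z Mf HZ. apply K. split.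
          { intros x Hx. apply HZ in Hx. destruct Hx as [n [V [HV Hx]]].
            apply (maps_rel _ _ _ _ _ Mf), proj2, K, proj1 in HV. auto. }
          destruct (pre Z) as [W HW]. exists W. split; [|exact HW].
          destruct (function_set om F (fun n V =>
            forall x, x ∈ V <-> real x /\ g x ∈ app f n)) as [f' [Mf' Rf']].
          * dfn.
          * intros n Hn. apply in_om in Hn.
            pose proof (app_codomain _ _ _ _ Mf Hn) as L. apply K in L.
            destruct L as [_ [V L]]. exists V. exact L.
          * intros n V V' _ _ _. apply pre_unique.
          * apply (proj2 (proj2 SF) f' W).
            -- split; [intros p Hp|intros n Hn].
               ++ apply (proj1 Mf') in Hp. apply prodc_elim in Hp.
                  apply prodc_elim. destruct Hp as [n [V [Hn L]]].
                  exists n, V. split; [|exact L]. apply in_om, Hn.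
               ++ apply (proj2 Mf'). apply in_om, Hn.
            -- intros x. rewrite HW, HZ. split.
               ++ intros [Rx [n [V [HV Hx]]]].
                  pose proof (proj1 (maps_rel _ _ _ _ _ Mf HV)) as Hn.
                  apply in_om in Hn.
                  destruct (maps_total _ _ _ n Mf' Hn) as [V' [_ HV']].
                  exists n, V'. split; [exact HV'|]. apply Rf' in HV'.
                  apply HV'. split; [exact Rx|].
                  rewrite <- (rel_app _ _ _ _ _ Mf HV). exact Hx.
               ++ intros [n [V [HV Hx]]]. apply Rf' in HV.
                  destruct HV as [Hn [_ HV]]. apply HV in Hx.
                  split; [apply Hx|]. exists n, (app f n).
                  split; [|apply Hx]. apply (maps_app _ _ _ _ Mf).
                  apply in_om, Hn.
      - intros U [SU OU]. apply K. split; [exact SU|].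
        destruct (pre U) as [W HW]. exists W. split; [|exact HW].
        apply HF. split; [intros x Hx; apply HW, Hx|]. intros x Hx.
        apply HW in Hx. destruct Hx as [Rx Hx].
        destruct (OU _ Hx) as [n [Hn L]]. destruct (Cg x n Rx Hn) as [m [Hm N]].
        exists m. split; [exact Hm|]. intros y Ry Hy. apply HW. auto. }
    apply K in KX. destruct KX as [_ [W [FW HW]]].
    rewrite (pre_unique X Y W HY HW). exact FW.
  - intros x. rewrite HY, HX. pose proof (Rg x). tauto.
Qed.

(** Different values differ at some number [k], and a finite part of [x] decides this. Negated, it
    makes graphs of continuous maps available as Borel conditions. *)
Lemma is_borel_neq g g' : continuous_fun g -> continuous_fun g' ->
  is_borel (fun x => g x <> g' x).
Proof.
  intros [Dg [Rg Cg]] [Dg' [Rg' Cg']]. apply is_borel_open; [dfn|].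
  intros x Rx N.
  assert (K : exists k, omega k /\ ~ (k ∈ g x <-> k ∈ g' x)).
  { apply NNPP. intros K. apply N, extensionality. intros k.
    apply NNPP. intros L. apply K. exists k. split; [|exact L].
    apply NNPP. intros O. apply L.
    split; intros Hk; destruct O; [apply (Rg x)|apply (Rg' x)]; trivial. }
  destruct K as [k [Hk K]]. pose proof (omega_succ k Hk) as Hsk.
  destruct (Cg x (succ k) Rx Hsk) as [m [Hm L]].
  destruct (Cg' x (succ k) Rx Hsk) as [m' [Hm' L']].
  destruct (upper_bound2 m m' Hm Hm') as [n [Hn Hn']]. exists n.
  split; [exact (le_omega_r _ _ Hn)|]. intros y Ry A E. apply K.
  assert (S : k ∈ succ k) by (apply in_adjoin; auto).
  rewrite (L y Ry (agree_le _ _ _ _ A Hn) k S).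
  rewrite (L' y Ry (agree_le _ _ _ _ A Hn') k S). rewrite E. tauto.
Qed.

End Borel.

#[export] Hint Resolve def_real def_set_of_reals def_agree def_open def_compl
  def_sigma def_borel def_continuous : dfn.

(** * Closure properties of the projective hierarchy *)

Section Projective.

Context {M : ZF_model}.
Implicit Types F T U X Y Z b f i j k m n p s t u w x y z : M.

Variables e h : M.
Hypothesis He : bijection e (prodc omega omega) omega.
Hypothesis Hh : projective_hierarchy h.

(* [proj 0] and [proj 1] are the coordinates of a pairing of reals. *)
Definition proj i w : M :=
  pick (fun y => forall t, t ∈ y <->
    omega t /\ exists j, rel e (pr i t) j /\ j ∈ w).

Lemma in_proj i w t :
  t ∈ proj i w <-> omega t /\ exists j, rel e (pr i t) j /\ j ∈ w.
Proof.
  apply (pick_spec (fun y => forall t, t ∈ y <->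
    omega t /\ exists j, rel e (pr i t) j /\ j ∈ w)).
  destruct (comprehension (fun t => exists j, rel e (pr i t) j /\ j ∈ w) om)
    as [y Hy]; [dfn|].
  exists y. intros u. rewrite Hy, in_om. tauto.
Qed.

Lemma continuous_fun_proj i : omega i -> continuous_fun (proj i).
Proof.
  intros Hi. split; [|split].
  - apply (definable_iff (fun a => forall t, t ∈ a 0 <->
      omega t /\ exists j, rel e (pr i t) j /\ j ∈ a 1)); [|dfn].
    intros a. split.
    + intros H. apply extensionality. intros t. rewrite H, in_proj. tauto.
    + intros -> t. apply in_proj.
  - intros x _ t Ht. apply in_proj in Ht. apply Ht.
  - intros x n Rx Hn. destruct He as [Me _].
    destruct (uniform_bound (fun t b => omega b /\
      forall j, rel e (pr i t) j -> j ∈ b) n) as [b [Hb K]]; trivial.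
    + dfn.
    + intros t b b' [Hb H] L. split; [exact (le_omega_r _ _ L)|].
      intros j Hj. exact (proj2 (lt_le_trans _ _ _ (conj Hb (H j Hj)) L)).
    + intros t Ht. assert (P : prodc omega omega (pr i t))
        by (apply prodc_pr; split; [exact Hi|exact (omega_mem n Hn t Ht)]).
      pose proof (app_codomain _ _ _ _ Me P) as O.
      exists (succ (app e (pr i t))). split; [apply omega_succ, O|].
      split; [apply omega_succ, O|]. intros j Hj.
      rewrite (rel_app _ _ _ _ _ Me Hj). apply in_adjoin. auto.
    + exists b. split; [exact Hb|]. intros y Ry A t Ht. rewrite !in_proj.
      split; intros [Ot [j [Hj Hx]]]; (split; [exact Ot|]); exists j;
        (split; [exact Hj|]); apply (A j); trivial; apply (K t Ht), Hj.
Qed.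

Lemma proj_surjective x y : real x -> real y ->
  exists w, real w /\ proj emp w = x /\ proj (succ emp) w = y.
Proof.
  intros Rx Ry. destruct He as [Me [inj _]].
  destruct (comprehension (fun j => exists t,
    (t ∈ x /\ rel e (pr emp t) j) \/ (t ∈ y /\ rel e (pr (succ emp) t) j)) om)
    as [w Hw]; [dfn|].
  assert (K : forall i t, omega i -> omega t ->
    exists j, rel e (pr i t) j /\ omega j).
  { intros i t Hi Ht. assert (P : prodc omega omega (pr i t))
      by (apply prodc_pr; auto).
    destruct (maps_total _ _ _ _ Me P) as [j [Hj Ej]]. exists j. auto. }
  exists w. split; [intros j Hj; apply in_om, Hw, Hj|].
  split; apply extensionality; intros t; rewrite in_proj; split.
  - intros [_ [j [Ej Hj]]]. apply Hw in Hj.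
    destruct Hj as [_ [t' [[Ht E]|[_ E]]]]; specialize (inj _ _ _ Ej E);
      apply pr_inj in inj; destruct inj as [E1 E2].
    + subst. exact Ht.
    + destruct (emp_neq_one E1).
  - intros Ht. split; [apply Rx, Ht|].
    destruct (K emp t omega_emp (Rx t Ht)) as [j [Ej Oj]]. exists j.
    split; [exact Ej|]. rewrite Hw, in_om. split; [exact Oj|].
    exists t. auto.
  - intros [_ [j [Ej Hj]]]. apply Hw in Hj.
    destruct Hj as [_ [t' [[_ E]|[Ht E]]]]; specialize (inj _ _ _ Ej E);
      apply pr_inj in inj; destruct inj as [E1 E2].
    + destruct (emp_neq_one (eq_sym E1)).
    + subst. exact Ht.
  - intros Ht. split; [apply Ry, Ht|].
    destruct (K (succ emp) t (omega_succ _ omega_emp) (Ry t Ht))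
      as [j [Ej Oj]]. exists j.
    split; [exact Ej|]. rewrite Hw, in_om. split; [exact Oj|].
    exists t. auto.
Qed.

Definition level n X : Prop := exists S, rel h n S /\ X ∈ S.

Definition is_level n (P : M -> Prop) : Prop :=
  exists X, level n X /\ forall x, x ∈ X <-> real x /\ P x.

Lemma level_zero X :
  level emp X <-> exists B, borel B /\ continuous_image X B.
Proof.
  destruct Hh as [Mh [H0 _]].
  assert (E : is_empty (@emp M)) by (apply is_empty_emp; reflexivity).
  assert (R := maps_app _ _ _ _ Mh omega_emp).
  rewrite <- (H0 emp _ E R X). split.
  - intros [S [RS HX]]. rewrite <- (rel_app _ _ _ _ _ Mh RS). exact HX.
  - intros HX. exists (app h emp). auto.
Qed.

Lemma level_succ n X : omega n -> (level (succ n) X <->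
  exists Y P, level n Y /\ compl P Y /\ continuous_image X P).
Proof.
  intros Hn. destruct Hh as [Mh [_ HS]].
  assert (E : is_succ (succ n) n) by (apply is_succ_succ; reflexivity).
  assert (R := maps_app _ _ _ _ Mh Hn).
  assert (R' := maps_app _ _ _ _ Mh (omega_succ n Hn)).
  pose proof (HS n (succ n) _ _ Hn E R R' X) as K. split.
  - intros [S [RS HX]]. rewrite (rel_app _ _ _ _ _ Mh RS) in HX. apply K in HX.
    destruct HX as [Y [P [HY L]]]. exists Y, P. split; [|exact L].
    exists (app h n). auto.
  - intros [Y [P [[S [RS HY]] L]]]. exists (app h (succ n)).
    split; [exact R'|]. apply K. exists Y, P. split; [|exact L].
    rewrite <- (rel_app _ _ _ _ _ Mh RS). exact HY.
Qed.

Lemma is_level_iff n (P Q : M -> Prop) :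
  (forall x, real x -> (P x <-> Q x)) -> is_level n P -> is_level n Q.
Proof.
  intros H [X [LX HX]]. exists X. split; [exact LX|]. intros x. rewrite HX.
  split; intros [Rx K]; split; trivial; apply (H x Rx), K.
Qed.

Lemma image_exists (g : M -> M) X : continuous_fun g -> set_of_reals X ->
  exists Y, continuous_image Y X /\
    forall y, y ∈ Y <-> real y /\ exists x, real x /\ x ∈ X /\ y = g x.
Proof.
  intros Cg SX. destruct (continuous_fun_set g Cg) as [f [Cf Rf]].
  pose proof Cg as [Dg [Rg _]].
  destruct (real_comprehension (fun y => exists x, real x /\ x ∈ X /\ y = g x))
    as [Y HY]; [dfn|].
  exists Y. split; [|exact HY]. exists f. split; [exact Cf|]. intros y.
  rewrite HY. split.
  - intros [_ [x [Rx [Hx ->]]]]. exists x. rewrite Rf. auto.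
  - intros [x [Hx K]]. apply Rf in K. destruct K as [Rx ->]. split; [auto|].
    exists x. auto.
Qed.

Lemma is_level_zero (g : M -> M) (B : M -> Prop) :
  continuous_fun g -> is_borel B ->
  is_level emp (fun y => exists x, real x /\ B x /\ y = g x).
Proof.
  intros Cg [X [BX HX]]. destruct (image_exists g X Cg (proj1 BX)) as [Y [CY HY]].
  exists Y. split; [apply level_zero; exists X; auto|]. intros y. rewrite HY.
  split; intros [Ry [x [Rx [Hx E]]]]; split; trivial; exists x; split; trivial;
    split; trivial; apply HX; auto.
Qed.

Lemma is_level_succ n (g : M -> M) (Q : M -> Prop) :
  omega n -> continuous_fun g -> is_level n Q ->
  is_level (succ n) (fun y => exists x, real x /\ ~ Q x /\ y = g x).
Proof.
  intros Hn Cg [X [LX HX]].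
  destruct (real_comprehension (fun x => x ∉ X)) as [P HP]; [dfn|].
  assert (SP : set_of_reals P) by (intros x Hx; apply HP, Hx).
  destruct (image_exists g P Cg SP) as [Y [CY HY]].
  exists Y. split; [apply level_succ; trivial; exists X, P; auto|].
  intros y. rewrite HY.
  split; intros [Ry [x [Rx [Hx E]]]]; split; trivial; exists x; split; trivial;
    split; trivial.
  - intros Qx. apply HP in Hx. apply Hx, HX. auto.
  - apply HP. split; trivial. intros K. apply HX in K. tauto.
Qed.

Lemma continuous_image_elim X B : continuous_image X B -> set_of_reals B ->
  exists g, continuous_fun g /\
    forall y, y ∈ X <-> exists x, real x /\ x ∈ B /\ y = g x.
Proof.
  intros [f [Cf HX]] SB. exists (app f). split; [apply continuous_fun_app, Cf|].
  destruct Cf as [Mf _]. intros y. rewrite (HX y). split.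
  - intros [x [Hx K]]. exists x. split; [apply SB, Hx|]. split; [exact Hx|].
    exact (rel_app _ _ _ _ _ Mf K).
  - intros [x [Rx [Hx ->]]]. exists x. split; [exact Hx|].
    exact (maps_app _ _ _ _ Mf Rx).
Qed.

(* The shape of this statement is preserved by passing to complements. *)
Definition level_closed n : Prop :=
  forall (X : M) (B C : M -> Prop) (g : M -> M),
  level n X -> is_borel B -> is_borel C -> continuous_fun g ->
  is_level n (fun x => C x \/ (B x /\ g x ∈ X)).

(** If [X] is the image of [D] under [g'], the new set is the projection of the codes of pairs [x],
    [d] with [C x], or with [B x], [d] in [D] and [g' d = g x]; these codes form a Borel set. *)
Lemma level_closed_zero : level_closed emp.
Proof.
  intros X B C g LX HB HC Cg. apply level_zero in LX.
  destruct LX as [D [BD CX]].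
  destruct (continuous_image_elim X D CX (proj1 BD)) as [g' [Cg' HX]].
  pose proof (continuous_fun_proj emp omega_emp) as C0.
  pose proof (continuous_fun_proj (succ emp) (omega_succ _ omega_emp)) as C1.
  apply (is_level_iff _ (fun x => exists w, real w /\
    (C (proj emp w) \/ (B (proj emp w) /\ proj (succ emp) w ∈ D /\
       ~ g' (proj (succ emp) w) <> g (proj emp w))) /\ x = proj emp w)).
  - intros x Rx. split.
    + intros [w [Rw [H ->]]]. destruct H as [H|[H1 [H2 H3]]]; [auto|].
      right. split; [exact H1|]. apply HX. exists (proj (succ emp) w).
      split; [apply C1, Rw|]. split; [exact H2|].
      apply NNPP. intros N. apply H3. congruence.
    + intros [H|[H K]].
      (* For [x] in [C] the second coordinate is arbitrary; [x] is a filler. *)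
      * destruct (proj_surjective x x Rx Rx) as [w [Rw [E _]]]. exists w.
        rewrite E. auto.
      * apply HX in K. destruct K as [d [Rd [Hd E]]].
        destruct (proj_surjective x d Rx Rd) as [w [Rw [E0 E1]]]. exists w.
        rewrite E0, E1. split; [exact Rw|split; [|reflexivity]]. right.
        split; [exact H|split; [exact Hd|]]. intros N. apply N. congruence.
  - apply is_level_zero; [exact C0|]. apply is_borel_or.
    + exact (is_borel_preimage _ C C0 HC).
    + apply is_borel_and; [exact (is_borel_preimage _ B C0 HB)|].
      apply is_borel_and.
      * exact (is_borel_preimage _ (elts D) C1 (is_borel_borel D BD)).
      * apply is_borel_not, is_borel_neq.
        -- exact (continuous_fun_comp g' _ Cg' C1).
        -- exact (continuous_fun_comp g _ Cg C0).
Qed.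

(** As at level zero, with [d] now in the complement of [Y]. The pairs to be projected form the
    complement of [Q], and [Q] again has the shape of the induction hypothesis, with Borel
    conditions in place of [C] and [B] and the second coordinate in place of [g]. *)
Lemma level_closed_succ n : omega n -> level_closed n -> level_closed (succ n).
Proof.
  intros Hn IH X B C g LX HB HC Cg. apply level_succ in LX; trivial.
  destruct LX as [Y [P [LY [HP CX]]]].
  assert (SP : set_of_reals P) by (intros x Hx; apply HP, Hx).
  destruct (continuous_image_elim X P CX SP) as [g' [Cg' HX]].
  pose proof (continuous_fun_proj emp omega_emp) as C0.
  pose proof (continuous_fun_proj (succ emp) (omega_succ _ omega_emp)) as C1.
  set (Q := fun w =>
    (~ C (proj emp w) /\ (~ B (proj emp w) \/
       g' (proj (succ emp) w) <> g (proj emp w))) \/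
    (~ C (proj emp w) /\ proj (succ emp) w ∈ Y)).
  assert (LQ : is_level n Q).
  { pose proof (is_borel_not _ (is_borel_preimage _ C C0 HC)) as K.
    apply (IH Y (fun w => ~ C (proj emp w)) (fun w => ~ C (proj emp w) /\
      (~ B (proj emp w) \/ g' (proj (succ emp) w) <> g (proj emp w)))); trivial.
    apply is_borel_and; [exact K|]. apply is_borel_or.
    - apply is_borel_not. exact (is_borel_preimage _ B C0 HB).
    - apply is_borel_neq.
      + exact (continuous_fun_comp g' _ Cg' C1).
      + exact (continuous_fun_comp g _ Cg C0). }
  apply (is_level_iff _ (fun x => exists w, real w /\ ~ Q w /\ x = proj emp w)).
  - intros x Rx. split.
    + intros [w [Rw [H ->]]].
      destruct (classic (C (proj emp w))) as [HCw|HCw]; [auto|]. right.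
      assert (HBw : B (proj emp w))
        by (apply NNPP; intros N; apply H; left; auto).
      split; [exact HBw|]. apply HX. exists (proj (succ emp) w).
      split; [apply C1, Rw|split].
      * apply HP. split; [apply C1, Rw|]. intros N. apply H. right. auto.
      * apply NNPP. intros N. apply H. left. split; [exact HCw|]. right.
        congruence.
    + intros [H|[H K]].
      * destruct (proj_surjective x x Rx Rx) as [w [Rw [E _]]]. exists w.
        unfold Q. rewrite E. tauto.
      * apply HX in K. destruct K as [d [Rd [Hd E]]].
        destruct (proj_surjective x d Rx Rd) as [w [Rw [E0 E1]]]. exists w.
        unfold Q. rewrite E0, E1. split; [exact Rw|split; [|reflexivity]].
        apply HP in Hd. destruct Hd as [_ Hd].
        intros [[_ [N|N]]|[_ N]]; [tauto|congruence|tauto].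
  - apply is_level_succ; trivial.
Qed.

(** Internal induction needs a first-order property, whereas [level_closed] quantifies over Rocq
    predicates and functions. Borel sets and continuous functions of the model replace them. *)
Lemma level_closed_internal n : level_closed n <->
  forall X B C f, level n X -> borel B -> borel C -> continuous f ->
  exists Z, level n Z /\ forall x, x ∈ Z <-> x ∈ C \/ (x ∈ B /\ app f x ∈ X).
Proof.
  split.
  - intros Hn X B C f LX HB HC Cf.
    destruct (Hn X (elts B) (elts C) (app f) LX (is_borel_borel B HB)
      (is_borel_borel C HC) (continuous_fun_app f Cf)) as [Z [LZ HZ]].
    exists Z. split; [exact LZ|]. intros x. rewrite HZ. unfold elts.
    split; [tauto|]. intros H. split; [|exact H].
    destruct H as [H|[H _]]; [exact (proj1 HC x H)|exact (proj1 HB x H)].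
  - intros Hn X P Q g LX [B [BB HB]] [C [BC HC]] Cg.
    destruct (continuous_fun_set g Cg) as [f [Cf Rf]].
    destruct (Hn X B C f LX BB BC Cf) as [Z [LZ HZ]]. exists Z.
    split; [exact LZ|]. intros x. rewrite HZ, HB, HC.
    assert (E : real x -> app f x = g x).
    { intros Rx. symmetry. apply (rel_app _ _ _ _ _ (proj1 Cf)), Rf. auto. }
    split.
    + intros [[Rx H]|[[Rx H] N]]; [auto|]. rewrite E in N by exact Rx. auto.
    + intros [Rx [H|[H N]]]; [auto|]. rewrite E by exact Rx. auto.
Qed.

Lemma level_closed_all n : omega n -> level_closed n.
Proof.
  intros Hn. apply level_closed_internal.
  assert (Dl : def2 level) by (unfold level; dfn).
  apply (omega_ind (fun n => forall X B C f,
    level n X -> borel B -> borel C -> continuous f -> exists Z,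
    level n Z /\ forall x, x ∈ Z <-> x ∈ C \/ (x ∈ B /\ app f x ∈ X)));
    trivial.
  - dfn.
  - apply level_closed_internal, level_closed_zero.
  - intros k Hk L. apply level_closed_internal, level_closed_succ; trivial.
    apply level_closed_internal, L.
Qed.

(** The codes of the pairs to be projected form a set of level [n]. As a level is climbed by
    continuous images of complements, two steps are taken: the complement under the identity, then
    the image of its complement under the first coordinate. *)
Lemma projective_section n (T X : M) (P : M -> M -> Prop) :
  omega n -> level n T ->
  is_borel (fun w => P (proj emp w) (proj (succ emp) w)) ->
  (forall x, x ∈ X <-> real x /\ exists u, u ∈ T /\ real u /\ P x u) ->
  projective X.
Proof.
  intros Hn LT HP HX.
  pose proof (continuous_fun_proj emp omega_emp) as C0.
  pose proof (continuous_fun_proj (succ emp) (omega_succ _ omega_emp)) as C1.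
  assert (BF : is_borel (fun _ : M => False))
    by (apply is_borel_open; [apply definable_False|tauto]).
  pose proof (level_closed_all n Hn T _ _ _ LT HP BF C1) as L.
  apply (is_level_succ _ (fun x => x) _ Hn continuous_fun_id) in L.
  apply (is_level_succ _ (proj emp) _ (omega_succ n Hn) C0) in L.
  destruct L as [X' [[S [RS LX]] HX']].
  exists h, (succ (succ n)), S. split; [exact Hh|].
  split; [apply omega_succ, omega_succ, Hn|split; [exact RS|]].
  replace X with X'; [exact LX|]. apply extensionality. intros x.
  rewrite HX, HX'. split; intros [Rx H]; (split; [exact Rx|]).
  - destruct H as [w [Rw [H ->]]]. exists (proj (succ emp) w).
    apply NNPP. intros N. apply H. exists w.
    pose proof (proj1 (proj2 C1) w Rw). tauto.
  - destruct H as [u [Hu [Ru H]]].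
    destruct (proj_surjective x u Rx Ru) as [w [Rw [E0 E1]]]. exists w.
    split; [exact Rw|]. split; [|auto]. intros [w' [_ [N E]]]. subst w'.
    apply N. right. rewrite E0, E1. auto.
Qed.

End Projective.

(** Failure of inclusion is witnessed by one decoded point [p] whose code [t] is missing from the
    second coordinate, and finite parts of both coordinates show it; so the relation is closed. *)
Lemma decode_subset_borel {M : ZF_model} (A e : M) :
  bijection e (prodc omega omega) omega ->
  is_borel (fun w => ~ exists t, omega t /\ t ∉ proj e (succ emp) w /\
    exists p, rel e p t /\ decode A e (proj e emp w) p).
Proof.
  intros He. pose proof (continuous_fun_proj e He emp omega_emp) as [D0 [_ C0]].
  pose proof (continuous_fun_proj e He (succ emp) (omega_succ _ omega_emp))
    as [D1 [_ C1]].
  apply is_borel_not, is_borel_open; [dfn|].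
  intros w Rw [t [Ot [Nt [p [Ep Dp]]]]].
  destruct (decode_local A e _ p Dp) as [n [Hn Kn]].
  destruct (C0 w n Rw Hn) as [m [Hm Km]].
  destruct (C1 w (succ t) Rw (omega_succ t Ot)) as [m' [Hm' Km']].
  destruct (upper_bound2 m m' Hm Hm') as [k [L L']]. exists k.
  split; [exact (le_omega_r _ _ L)|]. intros w' Rw' Aw.
  exists t. split; [exact Ot|split].
  - intros K. apply Nt. apply (Km' w' Rw' (agree_le _ _ _ _ Aw L') t); trivial.
    apply in_adjoin. auto.
  - exists p. split; [exact Ep|]. apply Kn, Km; trivial.
    exact (agree_le _ _ _ _ Aw L).
Qed.

Theorem theorem3p1 (M : ZF_model) (Gamma : M -> Prop)
  (hGamma : Gamma = set_of_reals \/ Gamma = projective)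
  (hDC : dependent_choice M)
  (hUnif : forall R : M,
    (forall p, p ∈ R -> prodc (infsubs omega) (infsubs omega) p) ->
    rel_in_class Gamma R ->
    (forall x, infsubs omega x -> exists y, rel R x y) ->
    exists A f : M,
      infsubs omega A /\
      maps f (infsubs (elts A)) (fun _ => True) /\
      (forall x y, rel f x y -> rel R x y))
  (hRamsey : forall X : M,
    (forall x, x ∈ X -> infsubs omega x) -> Gamma X -> ramsey X) :
  ~ exists F : M,
      ~ finite (elts F) /\
      fin_fin_mad F /\
      in_class Gamma (prodc omega omega) F.
Proof.
  intros [F [IF [HF [SF [e [T [He [HT GT]]]]]]]].
  destruct (infinite_sequence F hDC IF) as [A [MA inj]].
  (* Infinity of [z] is put into [X] because the Ramsey hypothesis concerns sets of infinite subsets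
     of omega. *)
  destruct (real_comprehension (fun z => ~ finite (elts z) /\
    exists y, y ∈ F /\ forall t, decode A e z t -> t ∈ y)) as [X HX]; [dfn|].
  apply (mad_not_ramsey A e F X hDC HF He MA inj).
  { intros z. rewrite HX. unfold infsubs, real. tauto. }
  apply hRamsey.
  { intros z Hz. apply HX in Hz. unfold infsubs, real in *. tauto. }
  destruct hGamma as [-> | ->].
  { intros z Hz. apply HX, Hz. }
  destruct GT as [h [n [S [Hh [Hn [RS HS]]]]]].
  (* The witness [y] in [F] is replaced by its image [u] in [T] under [e], since the hierarchy deals
     with sets of natural numbers. *)
  apply (projective_section e h He Hh n T X (fun z u => ~ finite (elts z) /\
    ~ exists t, omega t /\ t ∉ u /\ exists p, rel e p t /\ decode A e z p) Hn).
  { exists S. auto. }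
  { apply is_borel_and; [|apply decode_subset_borel, He].
    apply (is_borel_preimage (proj e emp) (fun z => ~ finite (elts z)));
      [apply continuous_fun_proj; [exact He|apply omega_emp]|].
    apply is_borel_infinite. }
  destruct He as [Me [einj _]].
  assert (K : forall z y u, y ∈ F -> image e y u ->
    ((forall t, decode A e z t -> t ∈ y) <->
     ~ exists t, omega t /\ t ∉ u /\ exists p, rel e p t /\ decode A e z p)).
  { intros z y u Fy Hu. split.
    - intros H [t [_ [Nt [p [Ep Dp]]]]]. apply Nt, Hu. exists p. auto.
    - intros H p Dp.
      (* A decoded point lies in the domain of [e], so it has a code that can be compared with
         [u]. *)
      assert (Pp : prodc omega omega p).
      { destruct Dp as [s [i [_ [_ Ct]]]].
        destruct Ct as [j [l [a [b [c [a' [b' [c' [k [m [_ [_ [_ [_ [[Q R] ->]]]]]]]]]]]]]]].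
        apply prodc_pr. split.
        - exact (le_omega_r _ _ (proj1 Q)).
        - exact (le_omega_r _ _ (proj1 R)). }
      destruct (maps_total _ _ _ p Me Pp) as [t [Ot Et]].
      apply NNPP. intros N. apply H. exists t. split; [exact Ot|split].
      + intros Ht. apply Hu in Ht. destruct Ht as [p' [Hp' Ep']].
        rewrite (einj _ _ _ Et Ep') in N. auto.
      + exists p. auto. }
  assert (Ru : forall y u, image e y u -> real u).
  { intros y u Hu t Ht. apply Hu in Ht. destruct Ht as [p [_ Ep]].
    apply (maps_rel _ _ _ _ _ Me Ep). }
  intros z. rewrite HX. split; intros [Rz [Iz H]]; (split; [exact Rz|]).
  - destruct H as [y [Fy H]].
    destruct (comprehension (fun t => exists p, p ∈ y /\ rel e p t) om)
      as [u Hu]; [dfn|].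
    assert (Iu : image e y u).
    { intros t. rewrite Hu. split; [tauto|]. intros Ht. split; [|exact Ht].
      destruct Ht as [p [_ Ep]]. apply in_om.
      apply (maps_rel _ _ _ _ _ Me Ep). }
    exists u. split; [apply HT; exists y; auto|]. split; [exact (Ru y u Iu)|].
    split; [exact Iz|]. apply (K z y u Fy Iu), H.
  - destruct H as [HuT [_ [Iz' H]]].
    apply HT in HuT. destruct HuT as [y [Fy Iu]].
    split; [exact Iz'|]. exists y. split; [exact Fy|].
    apply (K z y _ Fy Iu), H.
Qed.
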